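(* The general distance minimisation problem is undecidable.
   Context: An MDP is $\mathcal D=(S,Act,L,\varphi,\ell)$ with finite $S,Act,L$, a partial function $\varphi:S\times Act\rightharpoonup\mathrm{Distr}(S)$ (rational probabilities) and labelling $\ell:S\to L$. A path is $s_0{\sf m}_1s_1\cdots{\sf m}_ns_n$ with $\varphi(s_i,{\sf m}_{i+1})$ defined and $\varphi(s_i,{\sf m}_{i+1})(s_{i+1})>0$. A general strategy $\alpha$ maps each path to a distribution over actions available at its last state; it induces the (possibly infinite) LMC $\mathcal D(\alpha)$ whose states are paths, with transition $\tau(\rho)(\rho{\sf m}t)=\alpha(\rho)({\sf m})\varphi({\sf last}(\rho),{\sf m})(t)$ and label of $\rho$ the label of its last state; a state $s\in S$ is identified with the one-state path $s$. For an LMC $(S,L,\tau,\ell)$ the probabilistic bisimilarity distance $d$ is the least fixed point of $\Delta(e)(s,t)=1$ if $\ell(s)\ne\ell(t)$, and otherwise $\Delta(e)(s,t)=\min_{\omega\in\Omega(\tau(s),\tau(t))}\sum_{u,v}\omega(u,v)e(u,v)$, where $\Omega(\mu,\nu)$ is the set of couplings of $\mu,\nu$ (distributions on $S\times S$ with marginals $\mu,\nu$). The general distance minimisation problem asks, given an MDP, two states $s_1,s_2$ and a rational $\theta$, whether there is a general strategy $\alpha$ with $d(s_1,s_2)<\theta$ in $\mathcal D(\alpha)$. *)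

(* Defs.v *)
From HB Require Import structures.
From mathcomp Require Import all_boot all_order all_algebra.
From mathcomp Require Import reals.
Set Implicit Arguments.
Unset Strict Implicit.
Unset Printing Implicit Defensive.
Import Order.TTheory GRing.Theory Num.Theory.
Local Open Scope ring_scope.

(* An LMC whose state set lS may be infinite; every state s has a finite    *)
(* list lsupp M s containing the support of the distribution ltau s.          *)
Record lmc (R : realType) := LMC {
  lS : eqType;
  lL : eqType;
  ltau : lS -> lS -> R;
  lsupp : lS -> seq lS;
  llab : lS -> lL }.
Arguments ltau {R} _ _ _.
Arguments lsupp {R} _ _.
Arguments llab {R} _ _.

Section LMCdist.
Variables (R : realType) (M : lmc R).
Local Notation S := (lS M).

(* omega is a coupling of ltau s and ltau t (a distribution on S x S with *)
(* marginals ltau s and ltau t; it is necessarily supported on            *)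
(* lsupp M s x lsupp M t).                                                     *)
Definition coupling (s t : S) (omega : S -> S -> R) : Prop :=
  [/\ forall u v, 0 <= omega u v,
      forall u v, omega u v != 0 -> (u \in lsupp M s) && (v \in lsupp M t),
      forall u, \sum_(v <- undup (lsupp M t)) omega u v = ltau M s u
    & forall v, \sum_(u <- undup (lsupp M s)) omega u v = ltau M t v].

Definition coupling_cost (s t : S) (omega : S -> S -> R) (e : S -> S -> R) : R :=
  \sum_(u <- undup (lsupp M s)) \sum_(v <- undup (lsupp M t)) omega u v * e u v.

Definition is_min (P : R -> Prop) (x : R) : Prop :=
  P x /\ forall y, P y -> x <= y.

Definition Delta_val (e : S -> S -> R) (s t : S) (x : R) : Prop :=
  if llab M s != llab M t then x = 1
  else is_min (fun y => exists omega, coupling s t omega /\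
                                      y = coupling_cost s t omega e) x.

Definition Delta_fixpoint (e : S -> S -> R) : Prop :=
  (forall s t, 0 <= e s t <= 1) /\ (forall s t, Delta_val e s t (e s t)).

Definition bisim_dist (d : S -> S -> R) : Prop :=
  Delta_fixpoint d /\ forall e, Delta_fixpoint e -> forall s t, d s t <= e s t.

End LMCdist.

Record mdp := MDP {
  mS : finType;
  mA : finType;
  mL : eqType;
  mphi : mS -> mA -> option (mS -> rat);
  mlab : mS -> mL }.
Arguments mphi : clear implicits.
Arguments mlab : clear implicits.

Definition mdp_wf (D : mdp) : Prop :=
  forall s a mu, mphi D s a = Some mu ->
    (forall t, 0 <= mu t) /\ \sum_t mu t = 1.

Definition split_last (T : Type) (l : seq T) : option (seq T * T) :=
  if l is x :: l' then Some (belast x l', last x l') else None.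

Section MDPsem.
Variables (R : realType) (D : mdp).
Local Notation S := (mS D).
Local Notation A := (mA D).

(* raw path s0 m1 s1 ... mn sn  represented as (s0, [:: (m1,s1); ...]) *)
Definition rawpath := (S * seq (A * S))%type.

Fixpoint valid_from (s : S) (l : seq (A * S)) : bool :=
  match l with
  | [::] => true
  | (a, t) :: l' =>
      (if mphi D s a is Some mu then 0 < mu t else false) && valid_from t l'
  end.

Definition mpath := {p : rawpath | valid_from p.1 p.2}.

Definition last_state (p : mpath) : S :=
  last (val p).1 [seq x.2 | x <- (val p).2].

Definition path1 (s : S) : mpath := exist _ (s, [::]) (erefl true).

Definition strategy (alpha : mpath -> A -> R) : Prop :=
  forall rho,
    [/\ forall a, 0 <= alpha rho a,
        \sum_a alpha rho a = 1
      & forall a, 0 < alpha rho a -> isSome (mphi D (last_state rho) a)].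

Definition path_succ (rho : mpath) : seq mpath :=
  pmap insub [seq ((val rho).1, rcons (val rho).2 (a, t)) | a <- enum A, t <- enum S].

Definition path_tau (alpha : mpath -> A -> R) (rho rho' : mpath) : R :=
  match split_last (val rho').2 with
  | Some (q, (a, t)) =>
      if ((val rho').1 == (val rho).1) && (q == (val rho).2) then
        alpha rho a *
          (if mphi D (last_state rho) a is Some mu then ratr (mu t) else 0)
      else 0
  | None => 0
  end.

Definition path_lab (rho : mpath) : mL D := mlab D (last_state rho).

Definition induced_lmc (alpha : mpath -> A -> R) : lmc R :=
  @LMC R mpath (mL D) (path_tau alpha) path_succ path_lab.

Definition gen_dist_min (s1 s2 : S) (theta : rat) : Prop :=
  exists alpha, strategy alpha /\
    exists d, bisim_dist (M := induced_lmc alpha) d /\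
              d (path1 s1) (path1 s2) < ratr theta.

End MDPsem.

(* raw instance: (n, m, phi, lab, s1, s2, theta); states 'I_n, actions 'I_m, *)
(* labels nat; phi`_s`_a = Some l lists the probabilities l`_t.             *)
Definition raw_inst :=
  (nat * nat * seq (seq (option (seq rat))) * seq nat * nat * nat * rat)%type.

Definition ri_n (x : raw_inst) : nat := x.1.1.1.1.1.1.
Definition ri_m (x : raw_inst) : nat := x.1.1.1.1.1.2.
Definition ri_phi (x : raw_inst) := x.1.1.1.1.2.
Definition ri_lab (x : raw_inst) := x.1.1.1.2.
Definition ri_s1 (x : raw_inst) : nat := x.1.1.2.
Definition ri_s2 (x : raw_inst) : nat := x.1.2.
Definition ri_theta (x : raw_inst) : rat := x.2.

Definition ri_mdp (x : raw_inst) : mdp :=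
  @MDP ('I_(ri_n x)) ('I_(ri_m x)) nat
    (fun s a => omap (fun l (t : 'I_(ri_n x)) => nth 0 l t)
                     (nth None (nth [::] (ri_phi x) s) a))
    (fun s => nth 0%N (ri_lab x) s).

Definition ri_wf (x : raw_inst) : bool :=
  [&& size (ri_phi x) == ri_n x,
      all (fun row => size row == ri_m x) (ri_phi x),
      all (fun row => all (fun o => if o is Some l then
                         [&& size l == ri_n x, all (fun q : rat => 0 <= q) l
                           & \sum_(q <- l) q == 1 :> rat]
                       else true) row) (ri_phi x),
      size (ri_lab x) == ri_n x,
      (ri_s1 x < ri_n x)%N & (ri_s2 x < ri_n x)%N].

Definition ri_answer (R : realType) (x : raw_inst) : Prop :=
  exists (h1 : (ri_s1 x < ri_n x)%N) (h2 : (ri_s2 x < ri_n x)%N),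
    gen_dist_min R (D := ri_mdp x) (Ordinal h1) (Ordinal h2) (ri_theta x).

Definition encode (x : raw_inst) : nat := pickle x.

Inductive instr := INC of nat | DEC of nat & nat.
Definition rm_prog := seq instr.
Definition rm_config := (nat * seq nat)%type.

Definition rm_step (p : rm_prog) (c : rm_config) : rm_config :=
  let: (pc, regs) := c in
  if (pc < size p)%N then
    match nth (INC 0) p pc with
    | INC r => (pc.+1, set_nth 0%N regs r (nth 0%N regs r).+1)
    | DEC r j => if nth 0%N regs r is k.+1 then (pc.+1, set_nth 0%N regs r k)
                 else (j, regs)
    end
  else c.

Definition rm_halts_with (p : rm_prog) (x y : nat) : Prop :=
  exists k, let c := iter k (rm_step p) (0%N, [:: x]) in
            (size p <= c.1)%N /\ nth 0%N c.2 0 = y.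

Definition rm_decides_gdm (R : realType) (p : rm_prog) : Prop :=
  forall x : raw_inst, ri_wf x ->
    (ri_answer R x -> rm_halts_with p (encode x) 1) /\
    (~ ri_answer R x -> rm_halts_with p (encode x) 0).

(* Main.v *)
Require Import Defs.
From mathcomp Require Import all_boot all_order all_algebra.
From mathcomp Require Import reals.
From mathcomp Require Import boolp classical_sets topology normedtype derive.
From mathcomp Require Import ring lra zify.

(* Runs of a counter machine are turned into distances as follows.  The states
   reached from s2 do nothing but choose letters; the states reached from s1
   carry, besides the same choice of letters, a vector of masses, which
   represents integer counters c_r by 2^-c_r and 4^-c_r relative to a unit u.
   Choices and random moves alternate, and letters show in the labels, so that
   s1 gains nothing from deviating from the letters of s2: the distance is at
   least the expected loss under the random word chosen on the side of s2, and
   equal to the loss of a word if one word is chosen.  Per round half of the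
   remaining mass is tested: it is lost with probability 1/2 by default, and
   matched for ever otherwise; in a round which claims c_r = 0 the loss is
   raised by a multiple of u (1 - 2^-c_r)^2 >= 0, which is a linear function of
   the masses.  As u shrinks by a
   constant factor per round, a bonus for accepting proportional to u, which
   is small compared to the penalty for a wrong claim, is worth having only
   after an honest run.  Hence the distance can be pushed below 1/2 iff the
   machine has an accepting run.

   Counters of the machine are integers with zero tests and free choices, which
   is enough for Turing completeness: that a counter is non-negative is shown by
   counting it down to zero.  Given a register machine p deciding the problem, a
   fixed program B takes a number k, guesses the parts of the instance for B
   which do not depend on k, checks that k codes them, computes from them
   the code of the instance for (B, k), runs p on it, and accepts iff the
   output is 0.  Choosing k to be the code of those parts makes p answer wrongly
   on the instance for (B, k). *)
Set Implicit Arguments.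
Unset Strict Implicit.
Unset Printing Implicit Defensive.
Import Order.TTheory GRing.Theory Num.Theory.
Import numFieldNormedType.Exports.
Local Open Scope ring_scope.

(** * Distances in labelled Markov chains *)

Section LinearProgram.
Local Open Scope classical_set_scope.
Local Open Scope ring_scope.
Variables (R : realType) (n : nat) (J : finType).
Variables (A : J -> 'rV[R]_n) (b : J -> R).

Lemma continuous_row_dot (c : 'rV[R]_n) :
  continuous (fun v : 'rV[R]_n => \sum_i c 0 i * v 0 i).
Proof.
move=> v; suff H r : continuous_at v
    (fun w : 'rV[R]_n => \sum_(i <- r) c 0 i * w 0 i : R) by exact: H.
elim: r => [|i r IHr].
  have -> : (fun w : 'rV[R]_n => \sum_(i <- [::]) c 0 i * w 0 i : R) = fun=> (0 : R).
    by apply/funext => w; rewrite big_nil.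
  exact: cst_continuous.
have -> : (fun w : 'rV[R]_n => \sum_(j <- i :: r) c 0 j * w 0 j : R) =
  (fun w : 'rV[R]_n => c 0 i * w 0 i + \sum_(i <- r) c 0 i * w 0 i : R).
  by apply/funext => w; rewrite big_cons.
apply: (@continuousD R R^o _ (fun w : 'rV[R]_n => c 0 i * w 0 i)
  (fun w : 'rV[R]_n => \sum_(i <- r) c 0 i * w 0 i) v) => //.
apply: (@continuousM R _ (fun=> c 0 i) (fun w : 'rV[R]_n => w 0 i) v).
  exact: cst_continuous.
exact: (@coord_continuous R 1 n 0 i v).
Qed.

(** The box makes the polytope compact; entries of couplings satisfy it automatically. *)
Definition lp_feasible : set 'rV[R]_n :=
  [set v | (forall i, 0 <= v 0 i <= 1) /\
           forall j, \sum_i A j 0 i * v 0 i = b j].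

Lemma lp_feasible_compact : compact lp_feasible.
Proof.
apply: (@subclosed_compact _ _ [set v : 'rV[R]_n | forall i, (`[0, 1]%classic : set R) (v 0 i)]).
- rewrite (_ : lp_feasible = [set v : 'rV[R]_n | forall i, `[0, 1]%classic (v 0 i)] `&`
    \bigcap_(j in [set: J]) [set v : 'rV[R]_n | \sum_i A j 0 i * v 0 i = b j]).
    apply: closedI.
      rewrite (_ : [set v | _] = \bigcap_(i in [set: 'I_n])
         [set v : 'rV[R]_n | `[0, 1]%classic (v 0 i)]); last first.
        by apply/seteqP; split => v /= H i //; [move=> _; exact: H | exact: (H i Logic.I)].
      apply: closed_bigI => i _.
      apply: (@closed_comp _ R (fun v : 'rV[R]_n => v 0 i)).
        by move=> v _; exact: coord_continuous.
      exact: itv_closed.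
    apply: closed_bigI => j _.
    apply: (@closed_comp _ R (fun v : 'rV[R]_n => \sum_i A j 0 i * v 0 i) [set b j]).
      by move=> v _; exact: continuous_row_dot.
    exact: closed_eq.
  apply/seteqP; split => v /=.
    case=> H1 H2; split => [i|j _]; [|exact: H2].
    by rewrite in_itv /=; exact: H1.
  case=> H1 H2; split => [i|j]; [|exact: (H2 j I)].
  by have := H1 i; rewrite in_itv.
- have H : compact [set v : 'rV[R]_n | forall i, v ord0 i \in `[0, 1]].
    by apply: (@rV_compact R n (fun=> `[(0:R), 1]%classic)) => _; exact: segment_compact.
  exact: H.
- by move=> v [H _] i /=; rewrite in_itv /=; exact: H.
Qed.

Lemma lp_min (c : 'rV[R]_n) : lp_feasible !=set0 ->
  exists2 v, lp_feasible v & forall w, lp_feasible w ->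
    \sum_i c 0 i * v 0 i <= \sum_i c 0 i * w 0 i.
Proof.
move=> ne; have [|v vF vmin] := compact_EVT_min ne lp_feasible_compact 
  (f := fun v : 'rV[R]_n => \sum_i c 0 i * v 0 i).
  by apply: continuous_subspaceT; exact: continuous_row_dot.
exists v; first by rewrite inE in vF.
by move=> w wF; apply: vmin; rewrite inE.
Qed.
End LinearProgram.

Lemma fin_lp_min (R : realType) (I J : finType) (A : J -> I -> R) (b : J -> R)
    (c : I -> R) :
  let feas (x : I -> R) := (forall i, 0 <= x i <= 1) /\
    forall j, \sum_i A j i * x i = b j in
  (exists x, feas x) ->
  exists2 x, feas x & forall y, feas y -> \sum_i c i * x i <= \sum_i c i * y i.
Proof.
move=> feas [x0 x0F].
pose row (f : I -> R) : 'rV[R]_#|I| := \row_i f (enum_val i).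
pose unrow (v : 'rV[R]_#|I|) i := v 0 (enum_rank i).
have dotE (f g : I -> R) : \sum_i row f 0 i * row g 0 i = \sum_i f i * g i.
  by rewrite [RHS]big_enum_val /=; apply: eq_bigr => i _; rewrite !mxE.
have rowK v : row (unrow v) = v.
  by apply/rowP => i; rewrite mxE /unrow enum_valK.
have feasE x : feas x <-> lp_feasible (fun j => row (A j)) b (row x).
  split=> [[H1 H2]|[H1 H2]]; split=> i; rewrite ?dotE //.
  - by rewrite !mxE.
  - by have := H1 (enum_rank i); rewrite !mxE enum_rankK.
  - by rewrite -dotE.
have [|v vF vmin] := @lp_min R #|I| J (fun j => row (A j)) b (row c).
  by exists (row x0); exact/feasE.
exists (unrow v); first by apply/feasE; rewrite rowK.
by move=> y /feasE /vmin; rewrite -{1}(rowK v) !dotE.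
Qed.

(** * Optimal couplings and existence of the bisimilarity distance *)

Section LmcTheory.
Local Open Scope classical_set_scope.
Local Open Scope ring_scope.
Variables (R : realType) (M : lmc R).
Hypothesis tau_ge0 : forall s u, 0 <= ltau M s u.
Hypothesis tau_supp : forall s u, ltau M s u != 0 -> u \in lsupp M s.
Hypothesis tau_sum1 : forall s, \sum_(u <- undup (lsupp M s)) ltau M s u = 1.
Local Notation S := (lS M).
Implicit Types (s t u v : S) (e : S -> S -> R).

Lemma product_coupling s t :
  coupling s t (fun u v => ltau M s u * ltau M t v).
Proof.
split.
- by move=> u v; rewrite mulr_ge0.
- by move=> u v; rewrite mulf_eq0 negb_or => /andP[/tau_supp -> /tau_supp ->].
- by move=> u; rewrite -mulr_sumr tau_sum1 mulr1.
- by move=> v; rewrite -mulr_suml tau_sum1 mul1r.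
Qed.

Lemma coupling_le_l s t w u v : coupling s t w -> w u v <= ltau M s u.
Proof.
case=> w0 ws wl _; have [->|/ws/andP[_ vt]] := eqVneq (w u v) 0; first exact: tau_ge0.
rewrite -wl (bigD1_seq v) ?undup_uniq ?mem_undup //= lerDl.
by apply: sumr_ge0 => ? _; exact: w0.
Qed.

Lemma coupling_sum1 s t w : coupling s t w ->
  \sum_(u <- undup (lsupp M s)) \sum_(v <- undup (lsupp M t)) w u v = 1.
Proof. by case=> _ _ wl _; under eq_bigr do rewrite wl; exact: tau_sum1. Qed.

Lemma coupling_cost_bounds s t w e : (forall u v, 0 <= e u v <= 1) ->
  coupling s t w -> 0 <= coupling_cost s t w e <= 1.
Proof.
move=> e01 cw; have w0 := let: And4 h _ _ _ := cw in h.
apply/andP; split.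
  apply: sumr_ge0 => u _; apply: sumr_ge0 => v _; rewrite mulr_ge0 //.
  by case/andP: (e01 u v).
rewrite -(coupling_sum1 cw); apply: ler_sum => u _; apply: ler_sum => v _.
by rewrite ler_piMr //; case/andP: (e01 u v).
Qed.

Lemma coupling_cost_le s t w e e' : (forall u v, e u v <= e' u v) ->
  coupling s t w -> coupling_cost s t w e <= coupling_cost s t w e'.
Proof.
move=> ee' [w0 _ _ _]; apply: ler_sum => u _; apply: ler_sum => v _.
exact: ler_wpM2l.
Qed.

(** A coupling lives on the finite product of the two supports, where the marginal conditions are
    linear equations; an optimal one solves a linear program, which is feasible by the product
    coupling. *)
Lemma coupling_min s t e : exists2 w, coupling s t w &
  forall w', coupling s t w' -> coupling_cost s t w e <= coupling_cost s t w' e.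
Proof.
set us := undup (lsupp M s); set vs := undup (lsupp M t).
pose p := size us; pose q := size vs.
pose uu (i : 'I_p) := tnth (in_tuple us) i.
pose vv (j : 'I_q) := tnth (in_tuple vs) j.
have uuI : injective uu by apply/tuple_uniqP; exact: undup_uniq.
have vvI : injective vv by apply/tuple_uniqP; exact: undup_uniq.
pose A (j : 'I_p + 'I_q) (i : 'I_p * 'I_q) : R :=
  match j with inl a => (i.1 == a)%:R | inr c => (i.2 == c)%:R end.
pose b (j : 'I_p + 'I_q) : R :=
  match j with inl a => ltau M s (uu a) | inr c => ltau M t (vv c) end.
(* [fo] restricts a function to the product of the supports, and [gl] extends a vector by 0 outside
   of it. *)
pose fo (w : S -> S -> R) (i : 'I_p * 'I_q) := w (uu i.1) (vv i.2).
pose gl (x : 'I_p * 'I_q -> R) u v := \sum_i (uu i.1 == u)%:R * (vv i.2 == v)%:R * x i.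
have glE x i j : gl x (uu i) (vv j) = x (i, j).
  rewrite /gl (bigD1 (i, j)) //= !eqxx !mul1r big1 ?addr0 // => -[i' j'] ne /=.
  rewrite (inj_eq uuI) (inj_eq vvI); move: ne; rewrite xpair_eqE.
  by case: eqP; case: eqP; rewrite ?mulr0 ?mul0r.
have sum_us (F : S -> R) : \sum_(u <- us) F u = \sum_i F (uu i) by rewrite big_tnth.
have sum_vs (F : S -> R) : \sum_(v <- vs) F v = \sum_j F (vv j) by rewrite big_tnth.
have sumA j x : \sum_i A j i * x i =
    match j with inl a => \sum_c x (a, c) | inr c => \sum_a x (a, c) end.
  transitivity (\sum_a \sum_c A j (a, c) * x (a, c)).
    by rewrite pair_bigA; apply: eq_bigr => -[].
  case: j => [a|c] /=.
    rewrite (bigD1 a) //= eqxx [X in _ + X]big1 ?addr0.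
      by apply: eq_bigr => c _; rewrite mul1r.
    by move=> a' /negbTE ->; rewrite big1 // => k _; rewrite mul0r.
  apply: eq_bigr => a _; rewrite (bigD1 c) //= eqxx mul1r big1 ?addr0 //.
  by move=> c' /negbTE ->; rewrite mul0r.
have costE w : coupling_cost s t w e = \sum_i fo (fun u v => e u v) i * fo w i.
  rewrite /coupling_cost sum_us.
  transitivity (\sum_i \sum_j fo (fun u v => e u v) (i, j) * fo w (i, j)); last first.
    by rewrite pair_bigA; apply: eq_bigr => -[].
  by apply: eq_bigr => i _; rewrite sum_vs; apply: eq_bigr => j _; rewrite mulrC.
pose feas (x : 'I_p * 'I_q -> R) := (forall i, 0 <= x i <= 1) /\
    forall j, \sum_i A j i * x i = b j.
have foF w : coupling s t w -> feas (fo w).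
  move=> cw; have [w0 _ wl wr] := cw; split=> [i|[a|c]].
  - rewrite w0 /=; apply: le_trans (coupling_le_l _ _ cw) _.
    rewrite -(tau_sum1 s) (bigD1_seq (uu i.1)) ?undup_uniq ?mem_tnth //= lerDl.
    by apply: sumr_ge0 => ? _.
  - by rewrite sumA /fo /= -wl sum_vs.
  - by rewrite sumA /fo /= -wr sum_us.
have glF x : feas x -> coupling s t (gl x).
  move=> [x01 xs]; have x0 i : 0 <= x i by case/andP: (x01 i).
  split.
  - by move=> u v; apply: sumr_ge0 => i _; rewrite !mulr_ge0 ?ler0n.
  - move=> u v; apply: contraR => nuv; apply/eqP/big1 => i _.
    case: eqP => [eu|_]; last by rewrite !mul0r.
    case: eqP => [ev|_]; last by rewrite mulr0 mul0r.
    by case/negP: nuv; rewrite -eu -ev -mem_undup mem_tnth -mem_undup mem_tnth.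
  - move=> u; have [uus|nus] := boolP (u \in us).
      have /tnthP[i ->] : u \in in_tuple us by [].
      rewrite sum_vs -/(uu i); under eq_bigr do rewrite glE.
      by rewrite -(sumA (inl i)) xs.
    rewrite big1.
      apply/esym/eqP; apply: contraNT nus => /tau_supp; by rewrite mem_undup.
    move=> v _; apply: big1 => i _; case: eqP => [eu|]; last by rewrite !mul0r.
    by case/negP: nus; rewrite -eu mem_tnth.
  - move=> v; have [vvs|nvs] := boolP (v \in vs).
      have /tnthP[i ->] : v \in in_tuple vs by [].
      rewrite sum_us -/(vv i); under eq_bigr do rewrite glE.
      by rewrite -(sumA (inr i)) xs.
    rewrite big1.
      apply/esym/eqP; apply: contraNT nvs => /tau_supp; by rewrite mem_undup.
    move=> u _; apply: big1 => i _; case: (vv i.2 =P v) => [ev|]; last by rewrite mulr0 mul0r.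
    by case/negP: nvs; rewrite -ev mem_tnth.
have [|x xF xmin] := @fin_lp_min R _ _ A b (fo (fun u v => e u v)).
  by exists (fo (fun u v => ltau M s u * ltau M t v)); apply: foF; exact: product_coupling.
exists (gl x); first exact: glF.
move=> w' /foF /xmin; rewrite !costE; apply: le_trans.
by rewrite le_eqVlt; apply/orP; left; apply/eqP/eq_bigr => -[i j] _; rewrite /fo /= glE.
Qed.

Lemma Delta_val_exists s t e : exists x, Delta_val e s t x.
Proof.
rewrite /Delta_val; case: (_ != _); first by exists 1.
have [w cw wmin] := coupling_min s t e.
exists (coupling_cost s t w e); split; first by exists w.
by move=> _ [w' [cw' ->]]; exact: wmin.
Qed.

Lemma Delta_val_le s t e e' x x' : (forall u v, e u v <= e' u v) ->
  Delta_val e s t x -> Delta_val e' s t x' -> x <= x'.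
Proof.
move=> ee'; rewrite /Delta_val; case: ifP => _; first by move=> -> ->.
move=> [_ xmin] [[w [cw ->]] _]; apply: le_trans (coupling_cost_le ee' cw).
by apply: xmin; exists w.
Qed.

Lemma Delta_val_bounds s t e x : (forall u v, 0 <= e u v <= 1) ->
  Delta_val e s t x -> 0 <= x <= 1.
Proof.
rewrite /Delta_val => e01; case: ifP => _; first by move=> ->; rewrite ler01 lexx.
by move=> [[w [cw ->]] _]; exact: coupling_cost_bounds.
Qed.

Definition Delta_prefixpoint (e : S -> S -> R) : Prop :=
  (forall s t, 0 <= e s t <= 1) /\
  forall s t x, Delta_val e s t x -> x <= e s t.

(** Knaster-Tarski: the pointwise infimum of the pre-fixed points is the least fixed point. Its
    minimality among pre-fixed points is what later bounds distances from above. *)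
Theorem bisim_dist_exists : exists d, bisim_dist (M := M) d /\
  forall e, Delta_prefixpoint e -> forall s t, d s t <= e s t.
Proof.
pose E s t : set R := [set x | exists2 e, Delta_prefixpoint e & x = e s t].
pose d s t := inf (E s t).
have one_pre : Delta_prefixpoint (fun _ _ => 1).
  split=> [s t|s t x]; first by rewrite ler01 lexx.
  by case/Delta_val_bounds/andP => // u v; rewrite ler01 lexx.
have E1 s t : E s t 1 by exists (fun _ _ => 1).
have Elb s t : lbound (E s t) 0.
  by move=> _ [e [e01 _] ->]; case/andP: (e01 s t).
have hE s t : has_inf (E s t) by split; [exists 1|exists 0].
have d_le e : Delta_prefixpoint e -> forall s t, d s t <= e s t.
  move=> ep s t; apply: ge_inf; first by exists 0.
  by exists e.
have d01 s t : 0 <= d s t <= 1.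
  by rewrite (d_le _ one_pre) andbT; apply: lb_le_inf; [exists 1|].
have d_pre : Delta_prefixpoint d.
  split=> // s t x dx; apply: lb_le_inf; first by exists 1.
  move=> _ [e ep ->]; have [y ey] := Delta_val_exists s t e.
  exact: le_trans (Delta_val_le (d_le _ ep) dx ey) (ep.2 _ _ _ ey).
(* [d'] is the image of [d] under the functional; by monotonicity it is again a pre-fixed point, so
   [d] lies below it. *)
pose d' s t := xget 0 [set x | Delta_val d s t x].
have d'E s t : Delta_val d s t (d' s t).
  by have [x dx] := Delta_val_exists s t d; apply: (xgetPex 0); exists x.
have d'd s t : d' s t <= d s t by exact: d_pre.2.
have d'_pre : Delta_prefixpoint d'.
  split=> [s t|s t x d'x]; first exact: Delta_val_bounds (d'E s t).
  exact: Delta_val_le d'x (d'E s t).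
have dd' s t : d' s t = d s t by apply/le_anti; rewrite d'd d_le.
exists d; split=> //; split; first by split=> // s t; rewrite -dd'.
move=> e [e01 efix]; apply: d_le; split=> // s t x ex.
exact: Delta_val_le ex (efix s t).
Qed.

(** The minimum over couplings is at most the cost of the product coupling. *)
Lemma product_prefixpoint e : (forall s t, 0 <= e s t <= 1) ->
    (forall s t, llab M s != llab M t -> e s t = 1) ->
    (forall s t, llab M s = llab M t ->
      \sum_(u <- undup (lsupp M s)) \sum_(v <- undup (lsupp M t))
        ltau M s u * ltau M t v * e u v <= e s t) ->
  Delta_prefixpoint e.
Proof.
move=> e01 e1 eP; split=> // s t x; rewrite /Delta_val.
case: ifPn => [/e1 -> ->//|]; rewrite negbK => /eqP lab [_ xmin].
apply: le_trans (eP s t lab); apply: xmin.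
by exists (fun u v => ltau M s u * ltau M t v); split => //; exact: product_coupling.
Qed.

End LmcTheory.

(** * Lower bounds for fixed points *)

Section FixpointBounds.
Variables (R : realType) (M : lmc R).
Local Notation S := (lS M).
Implicit Types (s t u v : S) (e : S -> S -> R).

Lemma coupling_neq0_l s t w u v : coupling s t w -> w u v != 0 -> ltau M s u != 0.
Proof.
case=> w0 ws wl _ wn0; have /andP[_ vt] := ws _ _ wn0.
rewrite -wl (bigD1_seq v) ?undup_uniq ?mem_undup //= gt_eqF //.
by apply: ltr_pwDl; [rewrite lt_def wn0 w0 | apply: sumr_ge0].
Qed.

Lemma coupling_neq0_r s t w u v : coupling s t w -> w u v != 0 -> ltau M t v != 0.
Proof.
case=> w0 ws _ wr wn0; have /andP[us _] := ws _ _ wn0.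
rewrite -wr (bigD1_seq u) ?undup_uniq ?mem_undup //= gt_eqF //.
by apply: ltr_pwDl; [rewrite lt_def wn0 w0 | apply: sumr_ge0].
Qed.

Lemma fixpoint_cost e s t : Delta_fixpoint (M := M) e -> llab M s = llab M t ->
  exists2 w, coupling s t w & e s t = coupling_cost s t w e.
Proof.
move=> [_ /(_ s t)]; rewrite /Delta_val => + lab; rewrite lab eqxx /=.
by move=> [[w [cw ->]] _]; exists w.
Qed.

Lemma fixpoint_lab e s t : Delta_fixpoint (M := M) e -> llab M s != llab M t ->
  e s t = 1.
Proof. by move=> [_ /(_ s t) + lab]; rewrite /Delta_val lab. Qed.

(** A bound depending on the left successor alone has the same expectation under all couplings,
    fixed by the left marginal. Couplings vanish outside pairs of successors of positive
    probability. *)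
Lemma fixpoint_lower_l e s t (c : S -> R) : Delta_fixpoint (M := M) e ->
    llab M s = llab M t ->
    (forall u v, ltau M s u != 0 -> ltau M t v != 0 -> c u <= e u v) ->
  \sum_(u <- undup (lsupp M s)) ltau M s u * c u <= e s t.
Proof.
move=> ef lab ce; have [w cw ->] := fixpoint_cost ef lab.
have [w0 _ wl wr] := cw; apply: ler_sum => u _; rewrite -wl mulr_suml.
apply: ler_sum => v _; have [->|wn0] := eqVneq (w u v) 0; first by rewrite !mul0r.
by apply: ler_wpM2l => //; apply: ce;
  [apply: coupling_neq0_l cw wn0 | apply: coupling_neq0_r cw wn0].
Qed.

Lemma fixpoint_lower_r e s t (c : S -> R) : Delta_fixpoint (M := M) e ->
    llab M s = llab M t ->
    (forall u v, ltau M s u != 0 -> ltau M t v != 0 -> c v <= e u v) ->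
  \sum_(v <- undup (lsupp M t)) ltau M t v * c v <= e s t.
Proof.
move=> ef lab ce; have [w cw ->] := fixpoint_cost ef lab.
have [w0 _ wl wr] := cw; rewrite /coupling_cost exchange_big /=.
apply: ler_sum => v _; rewrite -wr mulr_suml.
apply: ler_sum => u _; have [->|wn0] := eqVneq (w u v) 0; first by rewrite !mul0r.
by apply: ler_wpM2l => //; apply: ce;
  [apply: coupling_neq0_l cw wn0 | apply: coupling_neq0_r cw wn0].
Qed.

End FixpointBounds.

(** * Induced Markov chains *)

Lemma big_pmap_insub (R : nmodType) (T : eqType) (P : pred T) (sT : subEqType P)
    (L : seq T) (G : sT -> R) :
  \sum_(u <- pmap insub L) G u = \sum_(x <- L) oapp G 0 (insub x).
Proof.
elim: L => [|x L IH] /=; first by rewrite !big_nil.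
rewrite big_cons -IH; case: (insub x) => [u|] /=; first by rewrite big_cons.
by rewrite add0r.
Qed.

Lemma split_last_rcons (T : Type) (l : seq T) x : split_last (rcons l x) = Some (l, x).
Proof. by case: l => //= y l; rewrite belast_rcons last_rcons. Qed.

Section InducedLmc.
Variables (R : realType) (D : mdp) (alpha : mpath D -> mA D -> R).
Hypothesis wfD : mdp_wf D.
Hypothesis strat : strategy alpha.
Local Notation S := (mS D).
Local Notation A := (mA D).
Implicit Types (rho : mpath D) (s t : S) (a : A).

Definition trans_prob s a t : R := if mphi D s a is Some mu then ratr (mu t) else 0.

(** The default [rho] is returned if the extension is no path, that is, if the transition has
    probability 0; in weighted sums this value never counts. *)
Definition extend rho a t : mpath D :=
  insubd rho ((val rho).1, rcons (val rho).2 (a, t)).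

Lemma trans_prob_ge0 s a t : 0 <= trans_prob s a t.
Proof.
rewrite /trans_prob; case E: (mphi D s a) => [mu|] //.
by rewrite ler0q; have [+ _] := wfD E; exact.
Qed.

Lemma trans_prob_sum1 s a : isSome (mphi D s a) -> \sum_t trans_prob s a t = 1.
Proof.
rewrite /trans_prob; case E: (mphi D s a) => [mu|] // _.
by rewrite -rmorph_sum; have [_ ->] := wfD E; rewrite rmorph1.
Qed.

Lemma valid_from_rcons s l a t :
  valid_from s (rcons l (a, t)) =
  valid_from s l && (trans_prob (last s [seq x.2 | x <- l]) a t != 0).
Proof.
elim: l s => [|[b u] l IH] s /=; last by rewrite IH andbA.
rewrite andbT /trans_prob; case E: (mphi D s a) => [mu|]; last by rewrite eqxx.
by rewrite fmorph_eq0 lt_def; have [+ _] := wfD E => ->; rewrite andbT.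
Qed.

Lemma valid_extend rho a t : trans_prob (last_state rho) a t != 0 ->
  valid_from (val rho).1 (rcons (val rho).2 (a, t)).
Proof. by move=> h; rewrite valid_from_rcons (valP rho). Qed.

Lemma val_extend rho a t : trans_prob (last_state rho) a t != 0 ->
  val (extend rho a t) = ((val rho).1, rcons (val rho).2 (a, t)).
Proof. by move=> h; rewrite insubdK //; exact: valid_extend. Qed.

Lemma last_extend rho a t : trans_prob (last_state rho) a t != 0 ->
  last_state (extend rho a t) = t.
Proof. by move=> h; rewrite /last_state val_extend //= map_rcons last_rcons. Qed.

Lemma path_tau_extend rho a t : trans_prob (last_state rho) a t != 0 ->
  path_tau alpha rho (extend rho a t) = alpha rho a * trans_prob (last_state rho) a t.
Proof.
by move=> h; rewrite /path_tau val_extend //= split_last_rcons !eqxx.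
Qed.

Lemma path_tau_ge0 rho rho' : 0 <= path_tau alpha rho rho'.
Proof.
rewrite /path_tau; case: split_last => [[q [a t]]|] //; case: ifP => // _.
by rewrite mulr_ge0 ?(trans_prob_ge0 _ _ t) //; have [] := strat rho.
Qed.

Lemma path_tau_neq0 rho rho' : path_tau alpha rho rho' != 0 ->
  exists a t, [/\ trans_prob (last_state rho) a t != 0, alpha rho a != 0
                & rho' = extend rho a t].
Proof.
rewrite /path_tau; case E: split_last => [[q [a t]]|]; last by rewrite eqxx.
case: ifP => [/andP[/eqP e1 /eqP e2]|]; last by rewrite eqxx.
rewrite mulf_eq0 negb_or => /andP[a0 p0]; exists a, t; split=> //.
apply/val_inj; rewrite val_extend //; case: (val rho') E e1 => [s l] /= E ->.
congr (_, _); rewrite -e2; case: l E => //= x l [<- <-].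
by rewrite lastI.
Qed.

Lemma path_succ_uniq rho : uniq (path_succ rho).
Proof.
apply: pmap_sub_uniq; apply: allpairs_uniq; rewrite ?enum_uniq //.
by move=> [a t] [b u] _ _ /= [] /rcons_inj [-> ->].
Qed.

Lemma mem_path_succ rho rho' : path_tau alpha rho rho' != 0 -> rho' \in path_succ rho.
Proof.
move=> /path_tau_neq0 [a [t [p0 _ ->]]].
rewrite mem_pmap_sub val_extend //; apply/allpairsP; exists (a, t).
by rewrite !mem_enum.
Qed.

(** Candidates which are not paths are dropped by [insub] on the left and carry the factor 0 on the
    right. *)
Lemma sum_path_succ rho (F : mpath D -> R) :
  \sum_(u <- undup (path_succ rho)) path_tau alpha rho u * F u =
  \sum_a alpha rho a * \sum_t trans_prob (last_state rho) a t * F (extend rho a t).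
Proof.
rewrite undup_id ?path_succ_uniq // /path_succ big_pmap_insub.
rewrite big_allpairs_dep /= big_enum /=; apply: eq_bigr => a _.
rewrite big_enum /= mulr_sumr; apply: eq_bigr => t _.
have [p0|p0] := eqVneq (trans_prob (last_state rho) a t) 0.
  rewrite p0 mul0r mulr0 insubN // valid_from_rcons (valP rho) /=.
  by rewrite -/(last_state rho) p0 eqxx.
case: insubP => [u _ uE|/negP[]]; last exact: valid_extend.
have -> : u = extend rho a t by apply/val_inj; rewrite val_extend.
by rewrite /= path_tau_extend // mulrA.
Qed.

Lemma path_tau_sum1 rho : \sum_(u <- undup (path_succ rho)) path_tau alpha rho u = 1.
Proof.
transitivity (\sum_(u <- undup (path_succ rho)) path_tau alpha rho u * 1).
  by apply: eq_bigr => u _; rewrite mulr1.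
rewrite (sum_path_succ rho (fun=> 1)); have [a0 a1 asupp] := strat rho.
rewrite -[RHS]a1.
apply: eq_bigr => a _; have [->|an0] := eqVneq (alpha rho a) 0; first by rewrite mul0r.
under eq_bigr do rewrite mulr1.
by rewrite trans_prob_sum1 ?mulr1 // asupp // lt_def an0 a0.
Qed.

End InducedLmc.

(** * Counter machines as MDPs *)

Lemma sum_option (V : nmodType) (T : finType) (F : option T -> V) :
  \sum_q F q = F None + \sum_t F (Some t).
Proof.
rewrite (bigD1 None) //=; congr (_ + _).
rewrite (reindex_omap Some id); first by apply: eq_bigl => t; rewrite eqxx.
by case.
Qed.

Lemma sum_dirac (V : pzSemiRingType) (T : finType) (x : T) (F : T -> V) :
  \sum_y (x == y)%:R * F y = F x.
Proof.
rewrite (bigD1 x) //= eqxx mul1r big1 ?addr0 // => y.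
by rewrite eq_sym => /negbTE ->; rewrite mul0r.
Qed.

(* [shift_ge] makes 2^-(shift l r) at most 2, so that a quarter of its square *)
(* is still a probability.                                                    *)
Record letters (K : nat) := Letters {
  letter : finType;
  idle : letter;
  ztest : letter -> {set 'I_K};
  shift : letter -> 'I_K -> int;
  accepting : letter -> bool;
  idle_ztest : ztest idle = finset.set0;
  idle_accepting : accepting idle = false;
  shift_ge : forall l r, -1 <= shift l r }.

Section Machine.
Variables (K : nat) (Ls : letters K).
Local Notation L := (letter Ls).
Local Notation a0 := (idle Ls).
Local Notation zs := (@ztest K Ls).
Local Notation dl := (@shift K Ls).
Local Notation hl := (@accepting K Ls).

Definition lupd (l : L) (c : 'I_K -> int) r := c r + dl l r.
Definition enabled (l : L) (c : 'I_K -> int) := [forall r in zs l, c r == 0].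

Fixpoint accepting_run (c : 'I_K -> int) (w : seq L) : bool :=
  if w is l :: w' then
    enabled l c && (if hl l then w' == [::] else accepting_run (lupd l c) w')
  else false.

Definition can_accept c := exists w, accepting_run c w.

(* [None] is the component carrying the unit of mass against which the       *)
(* counters are measured; [Some (r, b)] carries 2^-(c r) (for b = false) and *)
(* 4^-(c r) (for b = true) times that unit.                                  *)
Definition comp : finType := option ('I_K * bool).
(* [None] collects the mass which is not in any of the components. *)
Definition gcomp : finType := option comp.
(* [None] collects the mass which is matched for ever. *)
Definition tcomp : finType := option gcomp.
(** In [hub q] the mass at [q] waits for a letter; in [pend l q] the letter [l] has been chosen and
    the random move is due. *)
Definition state : finType := (bool + (tcomp + L * tcomp))%type.
Definition start : state := inl true.
Definition bad : state := inl false.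
Definition hub (q : tcomp) : state := inr (inl q).
Definition pend (l : L) (q : tcomp) : state := inr (inr (l, q)).

Section Coefficients.
Variable F : realFieldType.

(* [kappa] keeps all faults in the unit interval; [eta] is so small that all   *)
(* bonuses after a wrong zero test do not make up for its penalty.            *)
Definition kappa : F := (4 * K.+1%:R)^-1.
Definition eta : F := kappa / 8.

(** The unit shrinks by 4 per round. This leaves room for a counter going down by 1, which
    multiplies 4^-c by 4, so that the factor remains a probability. *)
Definition decay l (q : comp) : F :=
  if q is Some (r, b) then 4^-1 * (2 ^ (- dl l r)) ^+ b.+1 else 4^-1.

(** On top of the default 1/2, these are the coefficients of U, U T and U T^2 in kappa U (1 - T)^2,
    summed over the tested counters, less the bonus eta U for accepting. *)
Definition fault l (q : gcomp) : F :=
  match q with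
  | None => 2^-1
  | Some None => 2^-1 + (kappa *+ #|zs l| - eta *+ hl l)
  | Some (Some (r, b)) => 2^-1 + (if b then kappa else - (2 * kappa)) *+ (r \in zs l)
  end.

Definition weight (U : F) (T : 'I_K -> F) (q : comp) : F :=
  if q is Some (r, b) then U * T r ^+ b.+1 else U.

(* The weight missing to 1 is put on [None]. *)
Definition average (w : comp -> F) (X : gcomp -> F) : F :=
  X None + \sum_q w q * (X (Some q) - X None).

(** The expectation of [X] after a random move which keeps the component with probability
    [decay l q] and otherwise drops it to [None]. *)
Definition evolve l (X : gcomp -> F) (q : gcomp) : F :=
  if q is Some q' then decay l q' * X q + (1 - decay l q') * X None else X None.

Lemma kappa_gt0 : 0 < kappa.
Proof. by rewrite invr_gt0 mulr_gt0 ?ltr0n. Qed.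

Lemma kappa_card (k : nat) : (k <= K.+1)%N -> kappa *+ k <= 4^-1.
Proof.
move=> kK; rewrite -[kappa *+ k]mulr_natr /kappa invfM -mulrA ler_piMr ?invr_ge0 ?ler0n //.
by rewrite ler_pdivrMl ?ltr0n // mulr1 ler_nat.
Qed.

Lemma decay_bounds l q : 0 <= decay l q <= 1.
Proof.
case: q => [[r b]|] /=; last by lra.
have x0 : 0 <= (2 : F) ^ (- shift l r) by rewrite exprz_ge0.
have x2 : (2 : F) ^ (- shift l r) <= 2.
  by rewrite -[leRHS]expr1z ler_weXz2l ?ler1n //; have := shift_ge l r; lia.
by case: b; rewrite ?expr1 ?expr2; nra.
Qed.

Lemma fault_bounds l q : 0 <= fault l q <= 1.
Proof.
have k0 := kappa_gt0; have k1 := @kappa_card 1 isT; rewrite mulr1n in k1.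
case: q => [[[r b]|]|] /=; last by lra.
- by case: (r \in zs l); case: b; rewrite ?mulr1n ?mulr0n; lra.
- have kz : kappa *+ #|zs l| <= 4^-1.
    by apply: kappa_card; rewrite (leq_trans (max_card _)) ?card_ord.
  have kz0 : 0 <= kappa *+ #|zs l| by rewrite mulrn_wge0 // ltW.
  have : 0 <= eta *+ hl l <= kappa / 8.
    by rewrite /eta; case: (hl l); rewrite ?mulr1n ?mulr0n; lra.
  by lra.
Qed.

(** Evolving values is adjoint to letting the weights decay. *)
Lemma average_evolve l w X :
  average w (evolve l X) = average (fun q => w q * decay l q) X.
Proof.
rewrite /average /=; congr (_ + _); apply: eq_bigr => q _; ring.
Qed.

Lemma averageD w X Y : average w (fun q => X q + Y q) = average w X + average w Y.
Proof.
rewrite /average addrACA -big_split /=; congr (_ + _); apply: eq_bigr => q _; ring.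
Qed.

Lemma averageZ w a X : average w (fun q => a * X q) = a * average w X.
Proof.
rewrite /average mulrDr mulr_sumr; congr (_ + _); apply: eq_bigr => q _; ring.
Qed.

Lemma average_sum w (I : finType) (X : I -> gcomp -> F) :
  average w (fun q => \sum_i X i q) = \sum_i average w (X i).
Proof.
rewrite /average big_split /=; congr (_ + _); rewrite exchange_big /=.
by apply: eq_bigr => q _; rewrite -sumrB mulr_sumr.
Qed.

Lemma sum_comp (X : comp -> F) :
  \sum_q X q = X None + \sum_r (X (Some (r, false)) + X (Some (r, true))).
Proof.
rewrite sum_option; congr (_ + _).
transitivity (\sum_r \sum_b X (Some (r, b))).
  by rewrite pair_bigA; apply: eq_bigr => -[].
by apply: eq_bigr => r _; rewrite big_bool addrC.
Qed.

Lemma average_fault l U T : average (weight U T) (fault l) =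
  2^-1 + (kappa * U * \sum_(r in zs l) (1 - T r) ^+ 2 - eta * U *+ hl l).
Proof.
rewrite /average; congr (_ + _); rewrite sum_comp /=.
have -> : \sum_(r in zs l) (1 - T r) ^+ 2 =
    \sum_(r in zs l) (- 2 * T r + T r ^+ 2) + #|zs l|%:R.
  rewrite -sumr_const -big_split /=; apply: eq_bigr => r _; ring.
rewrite [kappa * U * (_ + _)]mulrDr mulr_sumr [X in _ = X + _ - _]big_mkcond /=.
rewrite (_ : \sum_r _ = \sum_r (if r \in zs l then
    kappa * U * (-2 * T r + T r ^+ 2) else 0)); last first.
  by apply: eq_bigr => r _; case: (r \in zs l); rewrite ?mulr1n ?mulr0n /=; ring.
rewrite -[kappa *+ _]mulr_natr -[eta *+ _]mulr_natr -[eta * U *+ _]mulr_natr; ring.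
Qed.

Variable c0 : 'I_K -> nat.

(** There are [K.*2.+1] components, each of initial weight at most [unit0]; as n <= 2^n, the weights
    add up to at most 1. *)
Definition unit0 : F := (2 ^+ K.*2.+1)^-1.
Definition init_weight : comp -> F := weight unit0 (fun r => (2 ^+ c0 r)^-1).

Definition start_mu (z : state) : F :=
  match z with
  | inr (inl (Some None)) => 1 - \sum_q init_weight q
  | inr (inl (Some (Some q))) => init_weight q
  | _ => 0
  end.

(** One half of the mass is tested and goes to [bad] or to [hub None]. The other half moves on;
    [evolve] of an indicator is the probability of moving to [q']. *)
Definition pend_mu l (q : gcomp) (z : state) : F :=
  2^-1 * match z with
  | inl b => if b then 0 else fault l q
  | inr (inl None) => 1 - fault l q
  | inr (inl (Some q')) => evolve l (fun q'' => (q'' == q')%:R) q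
  | inr (inr _) => 0
  end.

Definition dirac (x z : state) : F := (x == z)%:R.

Lemma sum_state (V : nmodType) (X : state -> V) :
  \sum_z X z = X start + X bad + (X (hub None) + \sum_q X (hub (Some q)))
             + \sum_l \sum_q X (pend l q).
Proof.
rewrite !big_sumType /= big_bool -addrA; congr (_ + (_ + _)).
  by rewrite sum_option.
by rewrite pair_bigA; apply: eq_bigr => -[].
Qed.

Lemma start_mu_sum (X : state -> F) :
  \sum_z start_mu z * X z = average init_weight (fun q => X (hub (Some q))).
Proof.
rewrite sum_state /= !mul0r !add0r [X in _ + X]big1 ?addr0; last first.
  by move=> l _; rewrite big1 // => q _; rewrite mul0r.
rewrite sum_option /= /average mulrBl mul1r -addrA; congr (_ + _).
rewrite mulr_suml addrC -sumrB; apply: eq_bigr => q _; ring.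
Qed.

Lemma pend_mu_sum l q (X : state -> F) :
  \sum_z pend_mu l q z * X z = 2^-1 * (fault l q * X bad +
     (1 - fault l q) * X (hub None) + evolve l (fun q' => X (hub (Some q'))) q).
Proof.
rewrite sum_state /pend_mu /= !mulr0 !mul0r add0r [X in _ + X]big1 ?addr0; last first.
  by move=> l' _; rewrite big1 // => q' _; rewrite mul0r.
rewrite [X in _ + (_ + X)](_ : _ = 2^-1 * evolve l (fun q' => X (hub (Some q'))) q).
  by ring.
rewrite (eq_bigr (fun q' => 2^-1 * (evolve l (fun q'' => (q'' == q')%:R) q *
    X (hub (Some q'))))); last by move=> q' _; rewrite mulrA.
rewrite -mulr_sumr; congr (_ * _); case: q => [q|] /=; last exact: sum_dirac.
rewrite -(sum_dirac (Some q) (fun q' => X (hub (Some q')))).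
rewrite -(sum_dirac None (fun q' => X (hub (Some q')))).
rewrite !mulr_sumr -big_split; apply: eq_bigr => q' _ /=; ring.
Qed.

Lemma dirac_sum x (X : state -> F) : \sum_z dirac x z * X z = X x.
Proof. exact: sum_dirac. Qed.

Lemma init_weight_ge0 q : 0 <= init_weight q.
Proof.
have u0 : 0 <= unit0 by rewrite invr_ge0 exprn_ge0.
case: q => [[r b]|] //=; rewrite mulr_ge0 // exprn_ge0 // invr_ge0.
by rewrite exprn_ge0.
Qed.

Lemma init_weight_sum_le1 : \sum_q init_weight q <= 1.
Proof.
have u0 : 0 <= unit0 by rewrite invr_ge0 exprn_ge0.
apply: (@le_trans _ _ (\sum_(q : comp) unit0)).
  apply: ler_sum => -[[r b]|] _ //=; rewrite ler_piMr // exprn_ile1 //.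
    by rewrite invr_ge0 exprn_ge0.
  by rewrite invf_le1 ?exprn_gt0 // exprn_ege1 // ler1n.
rewrite sumr_const card_option card_prod card_ord card_bool -mulr_natr /unit0.
rewrite ler_pdivrMl ?exprn_gt0 ?ltr0n // mulr1 -natrX ler_nat muln2.
exact: ltnW (ltn_expl _ _).
Qed.

Lemma start_mu_ge0 z : 0 <= start_mu z.
Proof.
case: z => [//|[[[q|]|]|]] //=; first exact: init_weight_ge0.
by rewrite subr_ge0 init_weight_sum_le1.
Qed.

Lemma pend_mu_ge0 l q z : 0 <= pend_mu l q z.
Proof.
rewrite mulr_ge0 ?invr_ge0 //; have /andP[f0 f1] := fault_bounds l q.
case: z => [[]|[[q'|]|]] //=; last by rewrite subr_ge0.
case: q {f0 f1} => [q|] //=; have /andP[d0 d1] := decay_bounds l q.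
by rewrite addr_ge0 // mulr_ge0 // subr_ge0.
Qed.

Lemma start_mu_sum1 : \sum_z start_mu z = 1.
Proof.
transitivity (\sum_z start_mu z * 1); first by apply: eq_bigr => z _; rewrite mulr1.
rewrite (start_mu_sum (fun=> 1)) /average big1 ?addr0 // => q _.
by rewrite subrr mulr0.
Qed.

Lemma pend_mu_sum1 l q : \sum_z pend_mu l q z = 1.
Proof.
transitivity (\sum_z pend_mu l q z * 1); first by apply: eq_bigr => z _; rewrite mulr1.
by rewrite (pend_mu_sum _ _ (fun=> 1)); case: q => [q|] /=; field.
Qed.

Lemma dirac_sum1 x : \sum_z dirac x z = 1.
Proof.
transitivity (\sum_z dirac x z * 1); first by apply: eq_bigr => z _; rewrite mulr1.
exact: dirac_sum.
Qed.

End Coefficients.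

Arguments kappa {F}.
Arguments eta {F}.

(** * Rational coefficients and their real images *)

Section Ratr.
Variable F : realFieldType.

Lemma ratr_kappa : ratr kappa = kappa :> F.
Proof. by rewrite /kappa fmorphV rmorphM !rmorph_nat. Qed.

Lemma ratr_decay l q : ratr (decay rat l q) = decay F l q.
Proof.
by case: q => [[r b]|] /=;
  rewrite ?rmorphM ?rmorphXn /= ?fmorphXz ?fmorphV ?rmorph_nat.
Qed.

Lemma ratr_fault l q : ratr (fault rat l q) = fault F l q.
Proof.
case: q => [[[r b]|]|] /=; rewrite ?fmorphV ?rmorph_nat //.
  rewrite rmorphD /= rmorphMn /= fmorphV rmorph_nat.
  by case: b; rewrite /= ?rmorphN /= ?rmorphM /= ?rmorph_nat ratr_kappa.
rewrite rmorphD /= fmorphV rmorph_nat rmorphB /= !rmorphMn /= ratr_kappa.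
by rewrite /eta rmorphM /= ratr_kappa fmorphV rmorph_nat.
Qed.

Lemma ratr_evolve l X q :
  ratr (evolve l X q) = evolve l (fun q' => ratr (X q')) q :> F.
Proof.
case: q => [q|] //=.
by rewrite rmorphD /= 2!rmorphM /= rmorphB /= rmorph1 ratr_decay.
Qed.

Lemma ratr_init_weight c0 q : ratr (init_weight rat c0 q) = init_weight F c0 q.
Proof.
have u0 : ratr (unit0 rat) = unit0 F by rewrite /unit0 fmorphV rmorphXn rmorph_nat.
case: q => [[r b]|] //=; rewrite rmorphM rmorphXn /= u0.
by rewrite fmorphV rmorphXn rmorph_nat.
Qed.

Lemma ratr_start_mu c0 z : ratr (start_mu rat c0 z) = start_mu F c0 z.
Proof.
case: z => [[]|[[[q|]|]|]] /=; rewrite ?rmorph0 ?ratr_init_weight //.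
rewrite rmorphB rmorph1 rmorph_sum; congr (_ - _).
by apply: eq_bigr => q _; exact: ratr_init_weight.
Qed.

Lemma ratr_pend_mu l q z : ratr (pend_mu rat l q z) = pend_mu F l q z.
Proof.
rewrite /pend_mu rmorphM /= fmorphV rmorph_nat; congr (_ * _).
case: z => [[]|[[q'|]|]] /=; rewrite ?rmorph0 ?rmorphB ?rmorph1 ?ratr_fault //.
  by rewrite ratr_evolve; case: q => [q|] /=; rewrite !rmorph_nat.
by rewrite /= ratr_fault.
Qed.

Lemma ratr_dirac x z : ratr (dirac rat x z) = dirac F x z.
Proof. by rewrite /dirac rmorph_nat. Qed.

End Ratr.
End Machine.
Arguments kappa K {F}.
Arguments eta K {F}.
Arguments hub {K Ls}.
Arguments pend {K Ls}.
Arguments bad {K Ls}.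
Arguments start {K Ls}.

(** Only hubs offer a choice. The states [hub None] and [pend l None] merely alternate: they form
    the side of s2, and also absorb the mass which is matched for ever. *)
Definition trans_mu (K : nat) (Ls : letters K) (c0 : 'I_K -> nat)
    (x : state Ls) (a : letter Ls) : option (state Ls -> rat) :=
  match x with
  | inr (inl q) => Some (dirac rat (pend a q))
  | inl b => if a == idle Ls then
               Some (if b then start_mu rat c0 else dirac rat (bad)) else None
  | inr (inr (l, q)) => if a == idle Ls then
               Some (if q is Some q' then pend_mu rat l q' else dirac rat (hub None))
               else None
  end.

(** [start] looks like a pending idle letter, as it is compared with [pend] of [idle] and [None].
    Hubs all look alike, so after a random move only [bad] can be told apart from [hub None]. *)
Definition state_lab (K : nat) (Ls : letters K) (x : state Ls) : nat :=
  match x with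
  | inl b => if b then (enum_rank (idle Ls)).+2 else 1
  | inr (inl _) => 0
  | inr (inr (l, _)) => (enum_rank l).+2
  end.

Arguments trans_mu {K} Ls c0 x a.
Arguments state_lab {K} Ls x.

(** * Expected loss round by round *)

Section Averages.
Variables (F : realFieldType) (K : nat) (Ls : letters K).
Local Notation L := (letter Ls).
Implicit Types (U : F) (T : 'I_K -> F) (X : gcomp K -> F).

Lemma eq_average (w w' : comp K -> F) X X' : w =1 w' -> X =1 X' ->
  average w X = average w' X'.
Proof.
by move=> ww XX; rewrite /average XX; congr (_ + _); apply: eq_bigr => q _; rewrite ww XX.
Qed.

Lemma weight_decay (l : L) U T q :
  weight U T q * decay F l q =
  weight (U / 4) (fun r => T r * 2 ^ (- shift l r)) q.
Proof. by case: q => [[r b]|] //=; rewrite exprMn; ring. Qed.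

Definition round (l : L) X q : F := 2^-1 * (fault F l q + evolve l X q).

(** Half of the average is the loss tested now; the other half is the average of [X] for the updated
    counters and a quarter of the unit. *)
Lemma average_round (l : L) U T X :
  average (weight U T) (round l X) =
  2^-1 * (2^-1 + (kappa K * U * \sum_(r in ztest l) (1 - T r) ^+ 2
                  - eta K * U *+ accepting l)) +
  2^-1 * average (weight (U / 4) (fun r => T r * 2 ^ (- shift l r))) X.
Proof.
rewrite /round averageZ averageD mulrDr average_fault average_evolve.
by congr (_ + _ * _); apply: eq_average => // q; exact: weight_decay.
Qed.

Lemma convex_ge (I : finType) (p X : I -> F) (b : F) :
  (forall i, 0 <= p i) -> \sum_i p i = 1 -> (forall i, b <= X i) ->
  b <= \sum_i p i * X i.
Proof.
move=> p0 p1 bX; rewrite -[b]mul1r -p1 mulr_suml.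
by apply: ler_sum => i _; exact: ler_wpM2l.
Qed.

Lemma penalty_ge0 (l : L) T : 0 <= \sum_(r in ztest l) (1 - T r) ^+ 2.
Proof. by apply: sumr_ge0 => r _; exact: sqr_ge0. Qed.

Definition pow_config (c : 'I_K -> int) r : F := 2 ^ (- c r).

Lemma pow_config_lupd (l : L) c r :
  pow_config c r * 2 ^ (- shift l r) = pow_config (lupd l c) r.
Proof. by rewrite /pow_config /lupd opprD expfzDr ?pnatr_eq0. Qed.

(** For a nonzero integer c, 2^-c is at most 1/2 or at least 2. This gap makes a wrong zero test
    cost a fixed fraction of the unit. *)
Lemma pow_config_far (c : int) : c != 0 -> 4^-1 <= (1 - 2 ^ (- c)) ^+ 2 :> F.
Proof.
have far (a : F) : 2^-1 <= a -> 4^-1 <= a ^+ 2 by rewrite expr2 => ?; nra.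
case: c => [[|n]|n] // _.
  rewrite -exprnN -exprVn; apply: far; rewrite exprS.
  have : (2^-1 : F) ^+ n <= 1 by rewrite exprn_ile1 //; lra.
  by lra.
rewrite NegzE opprK -exprnP -sqrrN; apply: far; rewrite exprS.
have : 1 <= (2 : F) ^+ n by rewrite exprn_ege1 // ler1n.
by lra.
Qed.

Lemma kappa_eta : kappa K = 8 * eta K :> F.
Proof. by rewrite /eta mulrC divfK ?pnatr_eq0. Qed.

Lemma eta_gt0 : 0 < eta K :> F.
Proof. by rewrite /eta divr_gt0 ?kappa_gt0 ?ltr0n. Qed.

Lemma enabled_penalty (l : L) c : enabled l c ->
  \sum_(r in ztest l) (1 - pow_config c r) ^+ 2 = 0.
Proof.
move=> /forall_inP en; apply: big1 => r /en /eqP cr.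
by rewrite /pow_config cr oppr0 expr0z subrr expr2 mulr0.
Qed.

Lemma disabled_penalty (l : L) c : ~~ enabled l c ->
  4^-1 <= \sum_(r in ztest l) (1 - pow_config c r) ^+ 2.
Proof.
rewrite negb_forall_in => /existsP[r /andP[rz cr]].
apply: le_trans (pow_config_far cr) _; rewrite (bigD1 r) //= lerDl.
by apply: sumr_ge0 => ? _; exact: sqr_ge0.
Qed.

(** After the last letter the value is 1/2, which is the loss of idling for ever. *)
Fixpoint word_cost (w : seq L) : gcomp K -> F :=
  if w is l :: w' then round l (word_cost w') else fun=> 2^-1.

Lemma round_idle q : round (idle Ls) (fun=> 2^-1) q = 2^-1.
Proof.
rewrite /round; case: q => [[[r b]|]|] /=; rewrite ?idle_ztest ?idle_accepting;
  rewrite ?inE ?cards0 /= ?mulr0n ?subr0; by field.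
Qed.

Lemma word_cost_drop w j q :
  word_cost (drop j w) q = round (nth (idle Ls) w j) (word_cost (drop j.+1 w)) q.
Proof.
have [jw|jw] := ltnP j (size w); first by rewrite (drop_nth (idle Ls)).
by rewrite !drop_oversize ?(leq_trans jw) // nth_default //= round_idle.
Qed.

Lemma evolve_bounds (l : L) X q : (forall q, 0 <= X q <= 1) -> 0 <= evolve l X q <= 1.
Proof.
move=> X01; case: q => [q|] //=; have := decay_bounds F l q.
have := X01 None; have := X01 (Some q).
move=> /andP[? ?] /andP[? ?] /andP[? ?]; nra.
Qed.

Lemma round_bounds (l : L) X q : (forall q, 0 <= X q <= 1) -> 0 <= round l X q <= 1.
Proof.
move=> X01; rewrite /round; have := evolve_bounds l q X01; have := fault_bounds F l q.
move=> /andP[? ?] /andP[? ?]; lra.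
Qed.

Lemma word_cost_bounds w q : 0 <= word_cost w q <= 1.
Proof.
elim: w q => [|l w IH] q /=; first lra.
exact: round_bounds.
Qed.

Lemma average_const (w : comp K -> F) a : average w (fun=> a) = a.
Proof. by rewrite /average big1 ?addr0 // => q _; rewrite subrr mulr0. Qed.

(** An honest run pays no penalty: every round contributes the default, and the accepting one
    subtracts a positive bonus. *)
Lemma average_word_cost w c U : 0 < U -> accepting_run c w ->
  average (weight U (pow_config c)) (word_cost w) < 2^-1.
Proof.
elim: w c U => [|l w IH] c U U0 //= /andP[en acc].
rewrite average_round enabled_penalty // mulr0 add0r.
have e0 := eta_gt0; have eU : 0 < eta K * U by rewrite mulr_gt0.
have U4 : 0 < U / 4 by rewrite divr_gt0.
case: (accepting l) acc => [/eqP ->|acc] /=.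
  by rewrite average_const mulr1n; lra.
have := IH _ _ U4 acc; rewrite mulr0n.
rewrite (eq_average (w' := weight (U / 4) (pow_config (lupd l c))) (X' := word_cost w)) //.
  by lra.
by case=> [[r b]|] //=; rewrite pow_config_lupd.
Qed.

End Averages.

Section MachineMdp.
Variables (R : realType) (K : nat) (Ls : letters K) (c0 : 'I_K -> nat).
Local Notation L := (letter Ls).
Local Notation a0 := (idle Ls).
Local Notation St := (state Ls).
Variables (phi : St -> L -> option (St -> rat)).
End MachineMdp.

Lemma le_of_eq d (T : porderType d) (x y : T) : x = y -> (x <= y)%O.
Proof. by move=> ->. Qed.

(** * The MDP of a counter machine, up to renaming of states and labels *)

Section MachineMdp.
Variables (R : realType) (K : nat) (Ls : letters K) (c0 : 'I_K -> nat).
Local Notation L := (letter Ls).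
Local Notation a0 := (idle Ls).
Local Notation St := (state Ls).
Variables (S : finType) (Lab : eqType) (phi : S -> L -> option (S -> rat)).
Variables (lab : S -> Lab) (view : S -> St) (unview : St -> S).
Hypothesis viewK : cancel view unview.
Hypothesis unviewK : cancel unview view.
Hypothesis phiE : forall s a, match phi s a, trans_mu Ls c0 (view s) a with
  | Some mu, Some nu => forall t, mu t = nu (view t)
  | None, None => True
  | _, _ => False
  end.
Hypothesis labE : forall s t, (lab s == lab t) =
  (state_lab Ls (view s) == state_lab Ls (view t)).

Let D := MDP phi lab.

Lemma sum_view (V : nmodType) (X : St -> V) : \sum_t X (view t) = \sum_y X y.
Proof. by rewrite [RHS](reindex view) //; exists unview => y _. Qed.

Definition real_mu (x : St) (a : L) (y : St) : R :=
  if trans_mu Ls c0 x a is Some nu then ratr (nu y) else 0.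

Lemma trans_probE s a t : trans_prob R (D := D) s a t = real_mu (view s) a (view t).
Proof.
rewrite /trans_prob /real_mu /=; have := phiE s a.
by case: (phi s a) => [mu|]; case: (trans_mu Ls c0 (view s) a) => [nu|] // ->.
Qed.

Lemma trans_mu_distr x a nu : trans_mu Ls c0 x a = Some nu ->
  (forall y, 0 <= nu y) /\ \sum_y nu y = 1.
Proof.
have dir z : (forall y, 0 <= dirac rat z y) /\ \sum_(y : St) dirac rat z y = 1.
  by split=> [y|]; [exact: ler0n | exact: dirac_sum1].
case: x => [b|[q|[l q]]] /=; last 1 first.
- case: (a == a0) => // -[<-]; case: q => [q|]; last exact: dir.
  by split=> [y|]; [exact: (@pend_mu_ge0 K Ls) | exact: (@pend_mu_sum1 K Ls)].
- case: (a == a0) => // -[<-]; case: b; last exact: dir.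
  by split=> [y|]; [exact: start_mu_ge0 | exact: start_mu_sum1].
- by case=> <-; exact: dir.
Qed.

Lemma machine_mdp_wf : mdp_wf D.
Proof.
move=> s a mu /= E; have := phiE s a; rewrite E.
case E2: (trans_mu Ls c0 (view s) a) => [nu|] // muE.
have [nu0 nu1] := trans_mu_distr E2; split=> [t|]; first by rewrite muE.
by rewrite (eq_bigr _ (fun t _ => muE t)) (sum_view nu).
Qed.

Lemma dirac_neq0 (x y : St) : dirac R x y != 0 -> x = y.
Proof. by rewrite /dirac; case: (x =P y) => // _; rewrite eqxx. Qed.

Section Strategy.
Variable alpha : mpath D -> L -> R.
Hypothesis strat : strategy (D := D) alpha.
Implicit Types (rho s t u v : mpath D).

Definition cur rho : St := view (last_state rho).
Definition ext rho (a : L) (y : St) : mpath D := extend rho a (unview y).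

Lemma cur_ext rho a y : real_mu (cur rho) a y != 0 -> cur (ext rho a y) = y.
Proof.
by move=> h; rewrite /cur /ext (last_extend (R := R) machine_mdp_wf) ?trans_probE ?unviewK.
Qed.

Lemma size_ext rho a y : real_mu (cur rho) a y != 0 ->
  size (val (ext rho a y)).2 = (size (val rho).2).+1.
Proof.
by move=> h; rewrite /ext (val_extend (R := R) machine_mdp_wf) ?trans_probE ?unviewK //= size_rcons.
Qed.

Lemma sum_succ rho (F : mpath D -> R) :
  \sum_(u <- undup (path_succ rho)) path_tau alpha rho u * F u =
  \sum_a alpha rho a * \sum_y real_mu (cur rho) a y * F (ext rho a y).
Proof.
rewrite (sum_path_succ alpha machine_mdp_wf); apply: eq_bigr => a _; congr (_ * _).
rewrite -(sum_view (fun y => real_mu (cur rho) a y * F (ext rho a y))).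
by apply: eq_bigr => t _; rewrite trans_probE /ext viewK.
Qed.

Lemma tau_neq0 rho u : path_tau alpha rho u != 0 ->
  exists a y, [/\ real_mu (cur rho) a y != 0, alpha rho a != 0, cur u = y
                & u = ext rho a y].
Proof.
move=> /(path_tau_neq0 machine_mdp_wf) [a [t [p0 al0 ->]]].
exists a, (view t); rewrite trans_probE in p0.
split=> //; last by rewrite /ext viewK.
by rewrite /cur (last_extend (R := R) machine_mdp_wf) // trans_probE.
Qed.

Definition is_hub (x : St) := if x is inr (inl _) then true else false.

Lemma alpha_idle rho a : ~~ is_hub (cur rho) -> alpha rho a = (a == a0)%:R.
Proof.
move=> nh; have [al0 al1 als] := strat rho.
have ne b : b != a0 -> alpha rho b = 0.
  move=> ba; apply/eqP; apply: contraT => bn0.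
  have /als : 0 < alpha rho b by rewrite lt_def bn0 al0.
  rewrite /=; have := phiE (last_state rho) b; rewrite -/(cur rho).
  by case: (phi _ _) => // mu; case: (cur rho) nh => [c|[q|[l q]]] //= _; rewrite (negbTE ba).
have [->|/ne//] := eqVneq a a0.
by rewrite -al1 (bigD1 a0) //= big1 ?addr0.
Qed.

Lemma sum_succ_idle rho (F : mpath D -> R) : ~~ is_hub (cur rho) ->
  \sum_(u <- undup (path_succ rho)) path_tau alpha rho u * F u =
  \sum_y real_mu (cur rho) a0 y * F (ext rho a0 y).
Proof.
move=> nh; rewrite sum_succ (bigD1 a0) //= alpha_idle // eqxx mul1r [X in _ + X]big1 ?addr0 //.
by move=> a /negbTE an; rewrite alpha_idle // an mul0r.
Qed.

Lemma sum_succ_hub rho q (F : mpath D -> R) : cur rho = hub q ->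
  \sum_(u <- undup (path_succ rho)) path_tau alpha rho u * F u =
  \sum_l alpha rho l * F (ext rho l (pend l q)).
Proof.
move=> cE; rewrite sum_succ; apply: eq_bigr => l _; congr (_ * _); rewrite cE.
rewrite -(sum_dirac (pend l q) (fun y => F (ext rho l y))).
by apply: eq_bigr => y _; rewrite /real_mu /= ratr_dirac.
Qed.

Lemma real_mu_hub l q : real_mu (hub q) l (pend l q) != 0.
Proof. by rewrite /real_mu /= ratr_dirac /dirac eqxx oner_eq0. Qed.

Lemma tau_hub rho q u : cur rho = hub q -> path_tau alpha rho u != 0 ->
  exists2 l, cur u = pend l q & u = ext rho l (pend l q).
Proof.
move=> cE /tau_neq0 [a [y [p0 _ uy uE]]]; rewrite cE in p0; exists a => //.
  by move: p0; rewrite uy /real_mu /= ratr_dirac => /dirac_neq0.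
by move: p0; rewrite uE /real_mu /= ratr_dirac => /dirac_neq0 ->.
Qed.

Lemma real_mu_dirac_pend l : real_mu (pend l None) a0 (hub None) != 0.
Proof. by rewrite /real_mu /= eqxx ratr_dirac /dirac eqxx oner_eq0. Qed.

Lemma tau_pend_None rho l u : cur rho = pend l None -> path_tau alpha rho u != 0 ->
  cur u = hub None /\ u = ext rho a0 (hub None).
Proof.
move=> cE /tau_neq0 [a [y [p0 al0 uy uE]]].
have aE : a = a0.
  by move: al0; rewrite alpha_idle ?cE //; case: (a =P a0) => // _; rewrite eqxx.
move: p0; rewrite cE aE /real_mu /= eqxx ratr_dirac => /dirac_neq0 yE.
by split; [rewrite uy -yE | rewrite uE aE -yE].
Qed.

Lemma path_labE s t :
  (path_lab s == path_lab t) = (state_lab Ls (cur s) == state_lab Ls (cur t)).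
Proof. by rewrite /path_lab /= labE. Qed.

Lemma alpha_ge0 rho a : 0 <= alpha rho a.
Proof. by have [h _ _] := strat rho. Qed.

Lemma alpha_sum1 rho : \sum_a alpha rho a = 1.
Proof. by have [_ h _] := strat rho. Qed.

(** * Lower bound for an arbitrary strategy *)

Section LowerBound.
Variable d : mpath D -> mpath D -> R.
Hypothesis dfix : Delta_fixpoint (M := induced_lmc alpha) d.

Lemma d_ge0 s t : 0 <= d s t.
Proof. by have /andP[] := dfix.1 s t. Qed.

Lemma d_le1 s t : d s t <= 1.
Proof. by have /andP[] := dfix.1 s t. Qed.

Lemma d_lab s t : state_lab Ls (cur s) != state_lab Ls (cur t) -> d s t = 1.
Proof.
by move=> h; apply: (@fixpoint_lab R (induced_lmc alpha) d s t dfix); rewrite /= path_labE.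
Qed.

(* A lower bound for the distance to [t] after n rounds. *)
Fixpoint horizon_value n (t : mpath D) (q : gcomp K) : R :=
  if n is n'.+1 then
    \sum_l alpha t l *
      round l (horizon_value n' (ext (ext t l (pend l None)) a0 (hub None))) q
  else 0.

Lemma pend_lower n l s t q :
  (forall s t q, cur s = hub (Some q) -> cur t = hub None -> horizon_value n t q <= d s t) ->
  cur s = pend l (Some q) -> cur t = pend l None ->
  round l (horizon_value n (ext t a0 (hub None))) q <= d s t.
Proof.
move=> IH sE tE.
(* The successor of [t] is at [hub None], so a left successor at [bad] has distance 1 from it by its
   label, and mass at [hub None] is bounded below by 0. *)
pose c' (y : St) : R := match y with
  | inl _ => 1
  | inr (inl (Some q')) => horizon_value n (ext t a0 (hub None)) q'
  | _ => 0 end.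
have := @fixpoint_lower_l R (induced_lmc alpha) d s t (fun u => c' (cur u)) dfix.
rewrite /= (sum_succ_idle (fun u => c' (cur u))) ?sE //.
set lhs := (X in (_ -> _ -> X <= _) -> _); set rhs := (X in _ -> X <= _).
have -> : lhs = rhs.
  rewrite /lhs /rhs (eq_bigr (fun y => pend_mu R l q y * c' y)); last first.
    move=> y _; have [p0|p0] := eqVneq (real_mu (pend l (Some q)) a0 y) 0.
      rewrite p0; move: p0; rewrite /real_mu /= eqxx ratr_pend_mu => ->.
      by rewrite !mul0r.
    rewrite cur_ext ?sE //; congr (_ * _).
    by rewrite /real_mu /= eqxx ratr_pend_mu.
  by rewrite pend_mu_sum /= mulr0 addr0 mulr1.
apply; first by apply/eqP; rewrite path_labE sE tE.
move=> u v su tv; have [vE vE'] := tau_pend_None tE tv.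
case uE: (cur u) => [b|[[q'|]|[]]]; rewrite /c' ?d_ge0 //.
  rewrite d_lab // uE vE /=; by case: b {uE}.
by rewrite -vE'; apply: IH.
Qed.

(** The letters of [t] are averaged; [s] either shows the same letter, or a different label and
    hence distance 1. *)
Lemma horizon_value_le n s t q : cur s = hub (Some q) -> cur t = hub None ->
  horizon_value n t q <= d s t.
Proof.
elim: n s t q => [|n IH] s t q sE tE /=; first exact: d_ge0.
pose c' v : R := if cur v is inr (inr (l, None)) then
  round l (horizon_value n (ext v a0 (hub None))) q else 0.
have := @fixpoint_lower_r R (induced_lmc alpha) d s t c' dfix.
rewrite /= (sum_succ_hub c' tE).
rewrite (eq_bigr (fun l => alpha t l *
   round l (horizon_value n (ext (ext t l (pend l None)) a0 (hub None))) q)); last first.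
  by move=> l _; rewrite /c' cur_ext // tE real_mu_hub.
apply; first by apply/eqP; rewrite path_labE sE tE.
move=> u v su tv; have [l' uE _] := tau_hub sE su; have [l vE _] := tau_hub tE tv.
rewrite /c' vE /=; have [ll|ll] := eqVneq l' l.
  by apply: pend_lower => //; rewrite uE ll.
rewrite d_lab; last first.
  by rewrite uE vE /= !eqSS; apply: contraNneq ll => /ord_inj/enum_rank_inj ->.
(* That the bound is at most 1 follows from the path on which [s] copies the letter [l], which
   exists even if the strategy never takes it. *)
apply: le_trans (d_le1 (ext s l (pend l (Some q))) v).
by apply: pend_lower => //; rewrite cur_ext // sE real_mu_hub.
Qed.

Lemma average_horizon_value n t (U : R) T :
  average (weight U T) (horizon_value n.+1 t) =
  \sum_l alpha t l * average (weight U T)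
     (round l (horizon_value n (ext (ext t l (pend l None)) a0 (hub None)))).
Proof. by rewrite average_sum; apply: eq_bigr => l _; rewrite averageZ. Qed.

(** Penalties are squares, hence non-negative for arbitrary masses [T], and with the unit shrinking
    by 4 per round all future bonuses together stay below eta U. *)
Lemma horizon_value_ge n t (U : R) T : 0 <= U ->
  2^-1 * (1 - (2^-1) ^+ n) - eta K * U <= average (weight U T) (horizon_value n t).
Proof.
have e0 : 0 < eta K :> R by exact: eta_gt0.
elim: n t U T => [|n IH] t U T U0.
  rewrite average_const expr0 subrr mulr0 sub0r oppr_le0.
  by rewrite mulr_ge0 // ltW.
rewrite average_horizon_value; apply: convex_ge => [l||l]; rewrite ?alpha_ge0 ?alpha_sum1 //.
rewrite average_round exprS.
have U4 : 0 <= U / 4 by rewrite divr_ge0.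
have := IH (ext (ext t l (pend l None)) a0 (hub None)) _
  (fun r => T r * 2 ^ (- shift l r)) U4.
have : 0 <= kappa K * U * \sum_(r in ztest l) (1 - T r) ^+ 2.
  by rewrite !mulr_ge0 ?penalty_ge0 // ltW // kappa_gt0.
have : eta K * U *+ accepting l <= eta K * U.
  have h : 0 <= eta K * U by rewrite mulr_ge0 // ltW.
  by case: (accepting l); rewrite ?mulr1n ?mulr0n.
have : 0 <= eta K * U by rewrite mulr_ge0 // ltW.
by lra.
Qed.

(** While the zero tests are right, no acceptance is possible and no bonus is paid. The first wrong
    test costs at least kappa U / 4 = 2 eta U, more than the bonus eta U of this round and the eta U
    / 4 which later rounds can return. *)
Lemma horizon_value_safe n t (U : R) c : 0 <= U -> ~ can_accept Ls c ->
  2^-1 * (1 - (2^-1) ^+ n) <= average (weight U (pow_config R c)) (horizon_value n t).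
Proof.
have e0 : 0 < eta K :> R by exact: eta_gt0.
elim: n t U c => [|n IH] t U c U0 safe.
  by rewrite average_const expr0 subrr mulr0.
rewrite average_horizon_value; apply: convex_ge => [l||l]; rewrite ?alpha_ge0 ?alpha_sum1 //.
rewrite average_round exprS.
have U4 : 0 <= U / 4 by rewrite divr_ge0.
have eU : 0 <= eta K * U by rewrite mulr_ge0 // ltW.
have [en|dis] := boolP (enabled l c).
  rewrite enabled_penalty // mulr0 add0r.
  have nacc : accepting l = false.
    by apply/negP => al; apply: safe; exists [:: l]; rewrite /= en al.
  have safe' : ~ can_accept Ls (lupd l c).
    by move=> [w aw]; apply: safe; exists (l :: w); rewrite /= en nacc.
  have := IH (ext (ext t l (pend l None)) a0 (hub None)) _ _ U4 safe'.
  rewrite nacc mulr0n.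
  rewrite (eq_average (w' := weight (U / 4) (fun r => pow_config R c r * 2 ^ (- shift l r)))
    (X' := horizon_value n (ext (ext t l (pend l None)) a0 (hub None)))) //.
    by lra.
  by case=> [[r b]|] //=; rewrite pow_config_lupd.
have := horizon_value_ge n (ext (ext t l (pend l None)) a0 (hub None))
  (fun r => pow_config R c r * 2 ^ (- shift l r)) U4.
have : kappa K * U * 4^-1 <=
    kappa K * U * \sum_(r in ztest l) (1 - pow_config R c r) ^+ 2.
  by apply: ler_wpM2l; rewrite ?disabled_penalty // mulr_ge0 // ltW // kappa_gt0.
have : eta K * U *+ accepting l <= eta K * U.
  by case: (accepting l); rewrite ?mulr1n ?mulr0n.
rewrite kappa_eta; lra.
Qed.

Lemma dist_ge_average n s t : cur s = start -> cur t = pend a0 None ->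
  average (init_weight R c0) (horizon_value n (ext t a0 (hub None))) <= d s t.
Proof.
move=> sE tE.
pose c' (y : St) : R := if y is inr (inl (Some q)) then
  horizon_value n (ext t a0 (hub None)) q else 0.
have := @fixpoint_lower_l R (induced_lmc alpha) d s t (fun u => c' (cur u)) dfix.
rewrite /= (sum_succ_idle (fun u => c' (cur u))) ?sE //.
rewrite (eq_bigr (fun y => start_mu R c0 y * c' y)); last first.
  move=> y _; have [p0|p0] := eqVneq (real_mu start a0 y) 0.
    rewrite p0; move: p0; rewrite /real_mu /= eqxx ratr_start_mu => ->.
    by rewrite !mul0r.
  rewrite cur_ext ?sE //; congr (_ * _).
  by rewrite /real_mu /= eqxx ratr_start_mu.
rewrite start_mu_sum; apply; first by apply/eqP; rewrite path_labE sE tE.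
move=> u v su tv; have [vE vE'] := tau_pend_None tE tv.
case uE: (cur u) => [b|[[q'|]|[l [q'|]]]]; rewrite /c' ?d_ge0 //.
by rewrite -vE'; apply: horizon_value_le.
Qed.

Lemma dist_ge_half s t : cur s = start -> cur t = pend a0 None ->
  ~ can_accept Ls (fun r => (c0 r)%:Z) -> 2^-1 <= d s t.
Proof.
move=> sE tE safe; rewrite leNgt; apply/negP => dlt.
pose x := 2^-1 - d s t; have x0 : 0 < x by rewrite subr_gt0.
(* The horizon is chosen so long that the neglected rounds, of total value 2^-n / 2, do not fill the
   gap [x]. *)
have [n nx] : exists n : nat, x^-1 < 2 ^+ n.
  exists (Num.bound x^-1); apply: lt_trans (archi_boundP _) _; first by rewrite invr_ge0 ltW.
  by rewrite -natrX ltr_nat ltn_expl.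
have U0 : 0 <= unit0 K R by rewrite invr_ge0 exprn_ge0.
have := le_trans (horizon_value_safe n (ext t a0 (hub None)) U0 safe) _.
move/(_ (d s t)); rewrite (eq_average (w' := init_weight R c0)
  (X' := horizon_value n (ext t a0 (hub None)))) //; last first.
  by case=> [[r b]|] //=; rewrite /pow_config -exprnN.
move/(_ (dist_ge_average n sE tE)).
have : (2^-1) ^+ n < x.
  by rewrite exprVn -[x]invrK ltf_pV2 ?posrE ?exprn_gt0 ?invr_gt0.
rewrite /x; lra.
Qed.

End LowerBound.
End Strategy.

(** * Upper bound from an accepting word *)

Section UpperBound.
Variable w : seq L.

(** From the two initial states, round j = 0, 1, ... has its hub at path length 2j+1, whose half is
    j; both sides thus play the same letter, and [idle] past the end of the word. *)
Definition word_letter (rho : mpath D) : L :=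
  if cur rho is inr (inl _) then nth a0 w (size (val rho).2)./2 else a0.

Definition word_strategy (rho : mpath D) (a : L) : R := (word_letter rho == a)%:R.

Lemma word_strategyP : strategy (D := D) word_strategy.
Proof.
move=> rho; split=> [a||a]; first exact: ler0n.
  have := sum_dirac (word_letter rho) (fun=> 1 : R).
  by under eq_bigr do rewrite mulr1.
rewrite /word_strategy; case: (_ =P a) => [<-|_]; last by rewrite ltxx.
move=> _ /=; have := phiE (last_state rho) (word_letter rho).
rewrite -/(cur rho) /word_letter.
by case: (phi _ _) => //; case: (cur rho) => [b|[q|[l q]]] //=; rewrite eqxx.
Qed.

Let M := induced_lmc word_strategy.
Let tau := path_tau word_strategy.

(** The candidate pre-fixed point at path length [k]. At a hub the current letter is still to come;
    at a pending state it has been consumed, hence [(k.+1)./2]. The value 1 is safe for all other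
    pairs. *)
Definition pair_cost (x y : St) (k : nat) : R :=
  match x, y with
  | inr (inl q), inr (inl None) =>
      if q is Some q' then word_cost R (drop k./2 w) q' else 0
  | inr (inr (l, q)), inr (inr (l', None)) =>
      if l == l' then
        if q is Some q' then round l (word_cost R (drop (k.+1)./2 w)) q' else 0
      else 1
  | inl true, inr (inr (l', None)) =>
      if l' == a0 then average (init_weight R c0) (word_cost R (drop (k.+1)./2 w))
      else 1
  | _, _ => 1
  end.

Definition path_cost (s t : mpath D) : R :=
  if size (val s).2 == size (val t).2 then
    pair_cost (cur s) (cur t) (size (val s).2)
  else 1.

Lemma average_init_bounds (X : gcomp K -> R) : (forall q, 0 <= X q <= 1) ->
  0 <= average (init_weight R c0) X <= 1.
Proof.
move=> X01; rewrite -(start_mu_sum (Ls := Ls) c0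
  (fun y => if y is inr (inl (Some q)) then X q else 0)).
have X01' (y : St) : 0 <= (if y is inr (inl (Some q)) then X q else 0) <= 1.
  by case: y => [?|[[q|]|?]]; rewrite ?X01 // lexx ler01.
apply/andP; split.
  by apply: sumr_ge0 => y _; rewrite mulr_ge0 ?start_mu_ge0 //; case/andP: (X01' y).
rewrite -(@start_mu_sum1 K Ls R c0); apply: ler_sum => y _.
by rewrite ler_piMr ?start_mu_ge0 //; case/andP: (X01' y).
Qed.

Lemma path_cost_bounds s t : 0 <= path_cost s t <= 1.
Proof.
have h0 : 0 <= (0 : R) <= 1 by rewrite lexx ler01.
have h1 : 0 <= (1 : R) <= 1 by rewrite lexx ler01.
rewrite /path_cost; case: ifP => // _; rewrite /pair_cost.
case: (cur s) => [[]|[[q|]|[l [q|]]]]; case: (cur t) => [?|[[q'|]|[l' [q'|]]]] //.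
- by case: ifP => // _; apply: average_init_bounds => q; exact: word_cost_bounds.
- exact: word_cost_bounds.
- by case: ifP => // _; apply: round_bounds => q'; exact: word_cost_bounds.
- by case: ifP.
Qed.

Lemma path_cost_lab s t : state_lab Ls (cur s) != state_lab Ls (cur t) ->
  path_cost s t = 1.
Proof.
rewrite /path_cost; case: ifP => // _; rewrite /pair_cost.
case: (cur s) => [[]|[[q|]|[l [q|]]]]; case: (cur t) => [?|[[q'|]|[l' [q'|]]]] //=.
- by case: (l' =P a0) => // ->; rewrite eqxx.
- by case: (l =P l') => // ->; rewrite eqxx.
- by case: (l =P l') => // ->; rewrite eqxx.
Qed.

Lemma tau_sum1 s : \sum_(u <- undup (path_succ s)) tau s u = 1.
Proof. exact: path_tau_sum1 machine_mdp_wf word_strategyP _. Qed.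

Lemma tau_ge0 s u : 0 <= tau s u.
Proof. exact: path_tau_ge0 machine_mdp_wf word_strategyP _ _. Qed.

Lemma sum_succ_word s q (F : mpath D -> R) : cur s = hub q ->
  \sum_(u <- undup (path_succ s)) tau s u * F u =
  F (ext s (nth a0 w (size (val s).2)./2) (pend (nth a0 w (size (val s).2)./2) q)).
Proof.
move=> sE; rewrite (sum_succ_hub _ _ sE) /word_strategy /word_letter sE /=.
exact: sum_dirac.
Qed.

Lemma sum_succ_pend_None s l (F : mpath D -> R) : cur s = pend l None ->
  \sum_(u <- undup (path_succ s)) tau s u * F u = F (ext s a0 (hub None)).
Proof.
move=> sE; rewrite (sum_succ_idle word_strategyP) ?sE //.
rewrite -(sum_dirac (hub None) (fun y => F (ext s a0 y))).
by apply: eq_bigr => y _; rewrite /real_mu /= eqxx ratr_dirac.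
Qed.

(** Where the cost is not set to 1, the side of [t] moves deterministically, so the product is its
    only coupling with the moves of [s]. *)
Lemma path_cost_super s t :
  \sum_(u <- undup (path_succ s)) tau s u *
    (\sum_(v <- undup (path_succ t)) tau t v * path_cost u v) <= path_cost s t.
Proof.
have le1 : \sum_(u <- undup (path_succ s)) tau s u *
    (\sum_(v <- undup (path_succ t)) tau t v * path_cost u v) <= 1.
  rewrite -(tau_sum1 s); apply: ler_sum => u _; rewrite ler_piMr ?tau_ge0 //.
  rewrite -(tau_sum1 t); apply: ler_sum => v _; rewrite ler_piMr ?tau_ge0 //.
  by case/andP: (path_cost_bounds u v).
rewrite {2}/path_cost; case: eqP => // szE.
case sE: (cur s) => [[]|[q|[l q]]]; case tE: (cur t) => [?|[[q'|]|[l' [q'|]]]] //=.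
- case: eqP => // l'E; rewrite l'E in tE; rewrite -/start in sE.
  under eq_bigr do rewrite (sum_succ_pend_None _ tE).
  rewrite (sum_succ_idle word_strategyP) ?sE //.
  rewrite -(start_mu_sum (Ls := Ls) c0 (fun y => if y is inr (inl (Some q))
     then word_cost R (drop (size (val s).2).+1./2 w) q else 0)).
  apply/le_of_eq/eq_bigr => y _.
  have p0E : real_mu start a0 y = start_mu R c0 y by rewrite /real_mu /= eqxx ratr_start_mu.
  rewrite p0E; have [->|p0] := eqVneq (start_mu R c0 y) 0; first by rewrite !mul0r.
  congr (_ * _); rewrite -p0E -sE in p0.
  rewrite /path_cost cur_ext // size_ext //.
  have q0 : real_mu (cur t) a0 (hub None) != 0 by rewrite tE real_mu_dirac_pend.
  rewrite cur_ext // size_ext // szE eqxx.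
  move: p0; rewrite sE p0E.
  by case: y {p0E} => [[]|[[q|]|[l [q|]]]] //=; rewrite eqxx.
- under eq_bigr do rewrite (sum_succ_word _ tE).
  rewrite (sum_succ_word _ sE) -szE.
  set l := nth _ _ _.
  have q0 : real_mu (cur t) l (pend l None) != 0 by rewrite tE real_mu_hub.
  have p0 : real_mu (cur s) l (pend l q) != 0 by rewrite sE real_mu_hub.
  rewrite /path_cost !cur_ext // !size_ext // szE !eqxx /= eqxx.
  case: q {sE p0} => // q; rewrite (word_cost_drop R w) /l szE.
  exact: lexx.
- case: (l =P l') => // lE; subst l.
  under eq_bigr do rewrite (sum_succ_pend_None _ tE).
  have q0 : real_mu (cur t) a0 (hub None) != 0 by rewrite tE real_mu_dirac_pend.
  rewrite -/(pend l' q) in sE; case: q sE => [q|] sE; last first.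
    have p0 : real_mu (cur s) a0 (hub None) != 0 by rewrite sE real_mu_dirac_pend.
    rewrite (sum_succ_pend_None _ sE) /path_cost !cur_ext // !size_ext //.
    by rewrite szE eqxx.
  rewrite (sum_succ_idle word_strategyP) ?sE //.
  set X := word_cost _ _.
  have := pend_mu_sum l' q (fun y : St => if y is inl _ then (1 : R) else
     if y is inr (inl (Some q)) then X q else 0).
  rewrite mulr1 mulr0 addr0 -/(round _ _ _) => <-.
  apply/le_of_eq/eq_bigr => y _.
  have p0E : real_mu (pend l' (Some q)) a0 y = pend_mu R l' q y.
    by rewrite /real_mu /= eqxx ratr_pend_mu.
  rewrite p0E; have [->|p0] := eqVneq (pend_mu R l' q y) 0; first by rewrite !mul0r.
  congr (_ * _); rewrite -p0E -sE in p0.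
  rewrite /path_cost cur_ext // size_ext // cur_ext // size_ext // szE eqxx.
  move: p0; rewrite sE p0E.
  by case: y {p0E} => [[]|[[q''|]|[l [q''|]]]] //=;
    rewrite /X ?szE // /pend_mu mulr0 eqxx.
Qed.

Lemma word_distance s t : cur s = start -> cur t = pend a0 None ->
    size (val s).2 = 0%N -> size (val t).2 = 0%N ->
  exists d, bisim_dist (M := M) d /\ d s t <= average (init_weight R c0) (word_cost R w).
Proof.
move=> sE tE s0 t0.
have supp u v : tau u v != 0 -> v \in path_succ u.
  by move=> h; exact: (mem_path_succ machine_mdp_wf h).
have [d [dd dle]] := @bisim_dist_exists R M tau_ge0 supp tau_sum1.
exists d; split=> //.
have -> : average (init_weight R c0) (word_cost R w) = path_cost s t.
  by rewrite /path_cost s0 t0 eqxx sE tE /= eqxx drop0.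
apply: dle; apply: (@product_prefixpoint R M tau_ge0 supp tau_sum1) => //.
- exact: path_cost_bounds.
- by move=> u v; rewrite /= path_labE; exact: path_cost_lab.
- move=> u v _; apply: le_trans (path_cost_super u v).
  apply/le_of_eq/eq_bigr => u' _; rewrite mulr_sumr; apply: eq_bigr => v' _.
  by rewrite mulrA.
Qed.

End UpperBound.

Theorem machine_gen_dist_min (s1 s2 : S) : view s1 = start -> view s2 = pend a0 None ->
  gen_dist_min R (D := D) s1 s2 2^-1 <-> can_accept Ls (fun r => (c0 r)%:Z).
Proof.
move=> v1 v2; have half : ratr 2^-1 = 2^-1 :> R by rewrite fmorphV rmorph_nat.
split.
  move=> [alpha [strat [d [[dfix _] dlt]]]]; apply: contrapT => safe.
  have := @dist_ge_half alpha strat d dfix (path1 (D := D) s1) (path1 (D := D) s2) v1 v2 safe.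
  by rewrite leNgt -half dlt.
move=> [w acc]; exists (word_strategy w); split; first exact: word_strategyP.
have [d [dd dle]] := @word_distance w (path1 (D := D) s1) (path1 (D := D) s2) v1 v2 erefl erefl.
exists d; split=> //; rewrite half; apply: le_lt_trans dle _.
have U0 : 0 < unit0 K R by rewrite invr_gt0 exprn_gt0.
have := average_word_cost U0 acc.
rewrite (eq_average (w' := init_weight R c0) (X' := word_cost R w)) //.
by case=> [[r b]|] //=; rewrite /pow_config -exprnN.
Qed.

End MachineMdp.

(** * Programs over integer counters *)

Definition store := nat -> int.

Definition supd (s : store) (r : nat) (z : int) : store :=
  fun x => if x == r then z else s x.

(** [Inc] adds any constant in one step, so that an input can be loaded by a single instruction;
    decrements are by 1, as required by [shift_ge]. *)
Inductive basic := Nop | Inc of nat & nat | Dec of nat | Zero of nat.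

Definition basic_sem (b : basic) (s s' : store) : Prop :=
  match b with
  | Nop => s' = s
  | Inc r n => s' = supd s r (s r + n%:Z)
  | Dec r => s' = supd s r (s r - 1)
  | Zero r => s r = 0 /\ s' = s
  end.

Inductive cmd := Basic of basic | Seq of cmd & cmd | Alt of cmd & cmd | Star of cmd.

Inductive rtc (T : Type) (P : T -> T -> Prop) (x : T) : T -> Prop :=
  | rtc_refl : rtc P x x
  | rtc_step y z : P x y -> rtc P y z -> rtc P x z.

Lemma rtc_trans T (P : T -> T -> Prop) x y z : rtc P x y -> rtc P y z -> rtc P x z.
Proof. by elim=> [//|u v w uv _ IH /IH]; exact: rtc_step. Qed.

Lemma rtc_inv T (P : T -> T -> Prop) (I : T -> Prop) x y :
  (forall u v, I u -> P u v -> I v) -> rtc P x y -> I x -> I y.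
Proof. by move=> h; elim=> // u v w uv _ IH /h/(_ uv). Qed.

Fixpoint sem (c : cmd) (s s' : store) : Prop :=
  match c with
  | Basic b => basic_sem b s s'
  | Seq c1 c2 => exists2 t, sem c1 s t & sem c2 t s'
  | Alt c1 c2 => sem c1 s s' \/ sem c2 s s'
  | Star c => rtc (sem c) s s'
  end.

Definition basic_regs (b : basic) : seq nat :=
  match b with Nop => [::] | Inc r _ | Dec r | Zero r => [:: r] end.

Fixpoint cmd_regs (c : cmd) : seq nat :=
  match c with
  | Basic b => basic_regs b
  | Seq c1 c2 | Alt c1 c2 => cmd_regs c1 ++ cmd_regs c2
  | Star c => cmd_regs c
  end.

Definition edge := (nat * basic * nat)%type.

Fixpoint fresh_nodes (c : cmd) : nat :=
  match c with
  | Basic _ => 0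
  | Seq c1 c2 => (fresh_nodes c1 + fresh_nodes c2).+1
  | Alt c1 c2 => fresh_nodes c1 + fresh_nodes c2
  | Star c => (fresh_nodes c).+1
  end.

(* The flow graph of [c] from node [i] to node [j], with inner nodes taken   *)
(* from n, n+1, ..., n + fresh_nodes c - 1.                                   *)
Fixpoint graph (c : cmd) (i j n : nat) : seq edge :=
  match c with
  | Basic b => [:: (i, b, j)]
  | Seq c1 c2 => graph c1 i n n.+1 ++ graph c2 n j (n.+1 + fresh_nodes c1)
  | Alt c1 c2 => graph c1 i j n ++ graph c2 i j (n + fresh_nodes c1)
  | Star c => [:: (i, Nop, n), (n, Nop, j) & graph c n n n.+1]
  end.

Definition InE (e : edge) (E : seq edge) : Prop := List.In e E.

Lemma InE_cat e E1 E2 : InE e (E1 ++ E2) <-> InE e E1 \/ InE e E2.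
Proof. exact: List.in_app_iff. Qed.

Definition graph_step (E : seq edge) (x y : nat * store) : Prop :=
  exists2 b, InE (x.1, b, y.1) E & basic_sem b x.2 y.2.

Lemma graph_complete c i j n s s' E : (forall e, InE e (graph c i j n) -> InE e E) ->
  sem c s s' -> rtc (graph_step E) (i, s) (j, s').
Proof.
elim: c i j n s s' => [b|c1 IH1 c2 IH2|c1 IH1 c2 IH2|c IH] i j n s s' /= sub.
- by move=> bs; apply: rtc_step (rtc_refl _ _); exists b => //; apply: sub; left.
- move=> [t h1 h2]; apply: (@rtc_trans _ _ _ (n, t)).
    by apply: IH1 h1 => e ee; apply: sub; apply/InE_cat; left; exact: ee.
  by apply: IH2 h2 => e ee; apply: sub; apply/InE_cat; right; exact: ee.
- case=> h.
    by apply: IH1 h => e ee; apply: sub; apply/InE_cat; left; exact: ee.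
  by apply: IH2 h => e ee; apply: sub; apply/InE_cat; right; exact: ee.
- move=> h; apply: (@rtc_step _ _ _ (n, s)); first by exists Nop => //; apply: sub; left.
  apply: (@rtc_trans _ _ _ (n, s')).
    elim: h => [x|x y z xy _ h]; first exact: rtc_refl.
    by apply: rtc_trans h; apply: IH xy => e ee; apply: sub; right; right; exact: ee.
  by apply: rtc_step (rtc_refl _ _); exists Nop => //; apply: sub; right; left.
Qed.

Lemma graph_nodes c i j n u b v : InE (u, b, v) (graph c i j n) ->
  ((u == i) || (u == j) || (n <= u < n + fresh_nodes c)%N) /\
  ((v == i) || (v == j) || (n <= v < n + fresh_nodes c)%N).
Proof.
elim: c i j n => [b'|c1 IH1 c2 IH2|c1 IH1 c2 IH2|c IH] i j n /=.
- by case=> // -[-> _ ->]; rewrite !eqxx !orbT.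
- by case/InE_cat=> [/IH1|/IH2]; lia.
- by case/InE_cat=> [/IH1|/IH2]; lia.
- by case=> [[-> _ ->]|[[-> _ ->]|/IH]]; rewrite ?eqxx ?orbT; lia.
Qed.

Definition edges_valid (A : nat -> store -> Prop) (E : seq edge) : Prop :=
  forall u b v s s', InE (u, b, v) E -> A u s -> basic_sem b s s' -> A v s'.

(** A Floyd-style annotation: inner nodes receive strongest postconditions, and all other nodes keep
    theirs. Soundness then follows by invariance, with no need to decompose paths. *)
Lemma graph_annotate c i j n (A : nat -> store -> Prop) : (i < n)%N -> (j < n)%N ->
    (forall s s', A i s -> sem c s s' -> A j s') ->
  exists2 A', (forall u, (u < n)%N || (n + fresh_nodes c <= u)%N -> A' u = A u) &
    edges_valid A' (graph c i j n).
Proof.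
elim: c i j n A => [b|c1 IH1 c2 IH2|c1 IH1 c2 IH2|c IH] i j n A li lj h /=.
- exists A => // u b' v s s' [[<- <- <-]|//]; exact: h.
- pose A1 u := if u == n then fun s' => exists2 s, A i s & sem c1 s s' else A u.
  have A1E u : u != n -> A1 u = A u by rewrite /A1 => /negbTE ->.
  have [||s s' Ais cs|A2 A2E A2v] := IH1 i n n.+1 A1; [by lia|by lia| |].
    rewrite A1E in Ais; last by lia.
    by rewrite /A1 eqxx; exists s.
  have [||s s' Ais cs|A3 A3E A3v] := IH2 n j (n.+1 + fresh_nodes c1)%N A2; [by lia|by lia| |].
    rewrite A2E in Ais; last by lia.
    move: Ais; rewrite /A1 eqxx => -[s0 As0 cs0].
    rewrite A2E; last by lia.
    by rewrite A1E; [apply: (h s0) => //; exists s | lia].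
  exists A3; first by move=> u hu; rewrite A3E ?A2E ?A1E //; lia.
  move=> u b v s s' /InE_cat[] e; last exact: A3v e.
  have [hu hv] := graph_nodes e; rewrite !A3E; [exact: A2v e | lia | lia].
- have [|||A2 A2E A2v] := IH1 i j n A; [by lia|by lia|by move=> s s' a b; apply: (h s) => //; left|].
  have [||s s' Ais cs|A3 A3E A3v] := IH2 i j (n + fresh_nodes c1)%N A2; [by lia|by lia| |].
    by move: Ais; rewrite !A2E; [move=> a; apply: (h s) => //; right | lia | lia].
  exists A3; first by move=> u hu; rewrite A3E ?A2E //; lia.
  move=> u b v s s' /InE_cat[] e; last exact: A3v e.
  have [hu hv] := graph_nodes e; rewrite !A3E; [exact: A2v e | lia | lia].
- pose A1 u := if u == n then fun s' => exists2 s, A i s & rtc (sem c) s s' else A u.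
  have A1E u : u != n -> A1 u = A u by rewrite /A1 => /negbTE ->.
  have [|||A2 A2E A2v] := IH n n n.+1 A1; [by lia|by lia| |].
    move=> s s'; rewrite /A1 eqxx => -[s0 As0 cs0 cs]; exists s0 => //.
    by apply: rtc_trans cs0 _; apply: rtc_step (rtc_refl _ _).
  exists A2; first by move=> u hu; rewrite A2E ?A1E //; lia.
  move=> u b v s s' [[<- <- <-]|[[<- <- <-]|e]]; last exact: A2v e.
    rewrite !A2E; [|lia|lia]; rewrite A1E; last by lia.
    by rewrite /A1 eqxx => As -> /=; exists s => //; exact: rtc_refl.
  rewrite !A2E; [|lia|lia]; rewrite [A1 j]A1E; last by lia.
  by rewrite /A1 eqxx => -[s0 As0 cs0] -> /=; exact: h cs0.
Qed.

Lemma graph_sound c s s' :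
  rtc (graph_step (graph c 0 1 2)) (0%N, s) (1%N, s') -> sem c s s'.
Proof.
(* The entry is annotated by the single store [s], the exit by the results of [c] from it. *)
pose A u (t : store) := if u == 0%N then t = s else sem c s t.
have [|||A' AE Av] := @graph_annotate c 0%N 1%N 2%N A; [by []|by []|by move=> t t' ->|].
move=> r; have := rtc_inv (I := fun x => A' x.1 x.2) _ r.
rewrite /= !AE // /A /=; apply => // -[u t] [v t'] /= au [b e bs].
exact: Av e au bs.
Qed.

(** * Compilation of flow graphs to letters *)

Inductive instruction := Idle | Accept | Edge of edge.

Section Compile.
Variables (D : nat) (c : cmd).
Hypothesis regs_lt : all (fun r => (r < D)%N) (cmd_regs c).

Definition node_count := (fresh_nodes c).+2.
Definition compiled := [:: Idle, Accept & map Edge (graph c 0 1 2)].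
Definition instruction_at (i : 'I_(size compiled)) := nth Idle compiled i.

Local Notation K := (D + node_count)%N.

(* The control is held in one counter per node, in positions D, D+1, ..., of *)
(* which the current node's is 0 and all others are 1.                        *)
Definition instruction_ztest (a : instruction) : {set 'I_K} :=
  match a with
  | Idle => finset.set0
  | Accept => [set x : 'I_K | x == (D + 1)%N :> nat]
  | Edge (u, b, _) => [set x : 'I_K | (x == (D + u)%N :> nat) ||
                       (if b is Zero r then x == r :> nat else false)]
  end.

Definition basic_shift (b : basic) (x : nat) : int :=
  match b with
  | Inc r n => if x == r then n%:Z else 0
  | Dec r => - (x == r)%:Z
  | _ => 0
  end.

(** Control leaving [u] raises its counter from 0 to 1 and lowers that of [v] from 1 to 0; for u = v
    the two changes cancel. *)
Definition instruction_shift (a : instruction) (x : 'I_K) : int :=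
  match a with
  | Edge (u, b, v) => if (x < D)%N then basic_shift b x
      else (x == (D + u)%N :> nat)%:Z - (x == (D + v)%N :> nat)%:Z
  | _ => 0
  end.

Lemma instruction_shift_ge a x : -1 <= instruction_shift a x.
Proof.
case: a => // -[[u b] v] /=; case: ifP => _; last by case: eqP; case: eqP.
by case: b => //= r => [n|]; case: eqP.
Qed.

Definition compiled_letters : letters K :=
  @Letters K 'I_(size compiled) ord0
    (fun i => instruction_ztest (instruction_at i))
    (fun i => instruction_shift (instruction_at i))
    (fun i => if instruction_at i is Accept then true else false)
    erefl erefl (fun i x => instruction_shift_ge _ x).

Definition machine_config (v : nat) (s : store) (x : 'I_K) : int :=
  if (x < D)%N then s x else ((x - D)%N != v)%:Z.

Lemma graph_regs b u v : InE (u, b, v) (graph c 0 1 2) ->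
  all (fun r => (r < D)%N) (basic_regs b) .
Proof.
elim: c regs_lt 0%N 1%N 2%N => [b'|c1 IH1 c2 IH2|c1 IH1 c2 IH2|c' IH] /= rl i j n.
- by case=> // -[_ <- _].
- by move: rl; rewrite all_cat => /andP[r1 r2] /InE_cat[]; [exact: IH1|exact: IH2].
- by move: rl; rewrite all_cat => /andP[r1 r2] /InE_cat[]; [exact: IH1|exact: IH2].
- by case=> [[_ <- _]|[[_ <- _]|]] //; exact: IH.
Qed.

Lemma InE_nth e0 e E : InE e E -> exists2 k, (k < size E)%N & nth e0 E k = e.
Proof.
elim: E => //= e' E IH [->|/IH [k kl ke]]; first by exists 0%N.
by exists k.+1.
Qed.

Lemma nth_InE e0 E k : (k < size E)%N -> InE (nth e0 E k) E.
Proof. by elim: E k => //= e E IH [_|k kl]; [left | right; exact: IH]. Qed.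

Lemma instruction_at_cases (i : 'I_(size compiled)) :
  [\/ instruction_at i = Idle, instruction_at i = Accept |
      exists2 e, InE e (graph c 0 1 2) & instruction_at i = Edge e].
Proof.
rewrite /instruction_at; case: i => [[|[|k]] /= kl]; [exact: Or31|exact: Or32|].
rewrite !ltnS size_map in kl; apply: Or33.
pose e0 : edge := (0, Nop, 0)%N.
by exists (nth e0 (graph c 0 1 2) k); [exact: nth_InE | rewrite (nth_map e0)].
Qed.

Lemma instruction_at_Edge e : InE e (graph c 0 1 2) ->
  exists i : 'I_(size compiled), instruction_at i = Edge e.
Proof.
move=> /(InE_nth (0, Nop, 0)%N) [k kl ke].
have kl' : (k.+2 < size compiled)%N by rewrite /= !ltnS size_map.
by exists (Ordinal kl'); rewrite /instruction_at /= (nth_map (0, Nop, 0)%N) ?ke.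
Qed.

Lemma config_node u v s (h : (D + u < K)%N) :
  (machine_config v s (Ordinal h) == 0) = (u == v).
Proof.
rewrite /machine_config /= ifF; last by lia.
by rewrite addKn; case: (u == v).
Qed.

Lemma config_reg r v s (h : (r < K)%N) : (r < D)%N ->
  machine_config v s (Ordinal h) = s r.
Proof. by rewrite /machine_config /= => ->. Qed.

Definition basic_guard (b : basic) (s : store) : bool :=
  if b is Zero r then s r == 0 else true.

Definition basic_fun (b : basic) (s : store) : store :=
  match b with
  | Inc r n => supd s r (s r + n%:Z)
  | Dec r => supd s r (s r - 1)
  | _ => s
  end.

Lemma basic_semE b s s' : basic_sem b s s' <-> basic_guard b s /\ s' = basic_fun b s.
Proof.
case: b => [|r n|r|r] /=; try by split=> [->|[_ ->]].
by split=> [[/eqP]|[/eqP]].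
Qed.

Lemma edge_enabled i u b v w s cf : instruction_at i = Edge (u, b, v) ->
    InE (u, b, v) (graph c 0 1 2) -> cf =1 machine_config w s ->
  enabled (Ls := compiled_letters) i cf = (w == u) && basic_guard b s.
Proof.
move=> iE e cfE; have [hu _] := graph_nodes e; have rl := graph_regs e.
have uK : (D + u < K)%N by rewrite /node_count; lia.
apply/forall_inP/andP => [en|[/eqP wu gb] x].
  split.
    have := en (Ordinal uK); rewrite /= iE inE eqxx cfE config_node eq_sym.
    exact.
  case: b iE e rl en => //= r iE e; rewrite andbT => rD en.
  have rK : (r < K)%N by lia.
  have := en (Ordinal rK); rewrite /= iE inE /= eqxx orbT cfE config_reg //.
  exact.
rewrite /= iE inE => /orP[/eqP xu|xr].
  by rewrite cfE (_ : x = Ordinal uK) ?config_node ?wu //; apply/val_inj.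
case: b xr iE e rl gb => //= r /eqP xr iE e; rewrite andbT => rD gb.
by rewrite cfE /machine_config xr rD.
Qed.

Lemma edge_update i u b v s cf : instruction_at i = Edge (u, b, v) ->
    InE (u, b, v) (graph c 0 1 2) -> cf =1 machine_config u s ->
  lupd (Ls := compiled_letters) i cf =1 machine_config v (basic_fun b s).
Proof.
move=> iE e cfE x; rewrite /lupd /= iE /= cfE /machine_config.
case: ifP => xD.
  case: (b) => [|r n|r|r] /=; rewrite ?addr0 // /supd; case: eqP => [->|_];
  by rewrite ?oppr0 ?addr0.
have -> : (x == (D + u)%N :> nat) = ((x - D)%N == u) by lia.
have -> : (x == (D + v)%N :> nat) = ((x - D)%N == v) by lia.
by case: ((x - D)%N == u); case: ((x - D)%N == v).
Qed.

Lemma accept_enabled i w s cf : instruction_at i = Accept ->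
  cf =1 machine_config w s -> enabled (Ls := compiled_letters) i cf = (w == 1%N).
Proof.
move=> iE cfE; have oK : (D + 1 < K)%N by rewrite /node_count; lia.
apply/forall_inP/eqP => [en|w1 x].
  by have := en (Ordinal oK); rewrite /= iE inE /= eqxx cfE config_node => /(_ isT)/eqP.
rewrite /= iE inE => /eqP xE.
by rewrite cfE (_ : x = Ordinal oK) ?config_node ?w1 //; apply/val_inj.
Qed.

Lemma accepting_run_reach w v s cf : cf =1 machine_config v s ->
    accepting_run (Ls := compiled_letters) cf w ->
  exists s', rtc (graph_step (graph c 0 1 2)) (v, s) (1%N, s').
Proof.
elim: w v s cf => //= i w IH v s cf cfE /andP[en run].
case: (instruction_at_cases i) => [iE|iE|[[[u b] u'] e iE]].
- rewrite iE in run; apply: (IH v s _ _ run) => x.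
  by rewrite /lupd /= iE addr0.
- by rewrite (accept_enabled iE cfE) in en; rewrite (eqP en); exists s; exact: rtc_refl.
- rewrite (edge_enabled iE e cfE) in en; have /andP[/eqP vu gb] := en; subst v.
  rewrite iE in run; have [s' hs'] := IH u' _ _ (edge_update iE e cfE) run.
  exists s'; apply: rtc_step hs'; exists b => //=; exact/basic_semE.
Qed.

Lemma reach_accepting_run v s s' cf : cf =1 machine_config v s ->
    rtc (graph_step (graph c 0 1 2)) (v, s) (1%N, s') ->
  exists w, accepting_run (Ls := compiled_letters) cf w.
Proof.
move=> + r; move: r; set x := (v, s); set y := (1%N, s') => r.
rewrite -[v]/(x.1) -[s]/(x.2); have : y.1 = 1%N by [].
elim: r cf => {x y v s s'} [x|x y z [b e bs] _ IH] cf z1 cfE.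
  pose i : 'I_(size compiled) := @Ordinal (size compiled) 1 isT.
  have iE : instruction_at i = Accept by [].
  by exists [:: i]; rewrite /= (accept_enabled iE cfE) z1 /= eqxx.
have [i iE] := instruction_at_Edge e; have [gb yE] := (basic_semE _ _ _).1 bs.
have [] := IH (lupd (Ls := compiled_letters) i cf) z1.
  by move=> k; rewrite (edge_update iE e cfE) yE.
move=> w aw; exists (i :: w); rewrite /= (edge_enabled iE e cfE) eqxx gb /=.
by rewrite iE.
Qed.

Theorem compiled_can_accept s cf : cf =1 machine_config 0 s ->
  can_accept compiled_letters cf <-> exists s', sem c s s'.
Proof.
move=> cfE; split=> [[w aw]|[s' h]].
  by have [s' r] := accepting_run_reach cfE aw; exists s'; exact: graph_sound.
by apply: (@reach_accepting_run 0 s s' cf cfE); exact: (graph_complete (fun e he => he) h).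
Qed.

End Compile.

(** * Deterministic fragments and counting loops *)

Ltac case_regs := repeat match goal with |- context [?a == ?b] =>
  let e := fresh in case: (a =P b) => e; [try rewrite e | idtac] end.
Ltac store_eq := try reflexivity; apply/funext => ?; rewrite /supd; case_regs; lia.

(** Since commands are relations, this says both that [u] is reached and that nothing else is. *)
Definition runs (c : cmd) (s u : store) : Prop := forall t, sem c s t <-> t = u.

Lemma runs_sem c s u : runs c s u -> sem c s u.
Proof. by move=> h; apply/h. Qed.

Lemma sem_seq c1 c2 s u s' : runs c1 s u -> (sem (Seq c1 c2) s s' <-> sem c2 u s').
Proof.
move=> h /=; split=> [[t /h -> //]|h2]; exists u => //; exact: runs_sem.
Qed.

Lemma runs_seq c1 c2 s u v : runs c1 s u -> runs c2 u v -> runs (Seq c1 c2) s v.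
Proof. by move=> h1 h2 t; rewrite (sem_seq _ _ h1). Qed.

Lemma eq_runs c s u s' u' : runs c s u -> s = s' -> u = u' -> runs c s' u'.
Proof. by move=> h <- <-. Qed.

Lemma runs_inc r n s : runs (Basic (Inc r n)) s (supd s r (s r + n%:Z)).
Proof. by []. Qed.

Lemma runs_dec r s : runs (Basic (Dec r)) s (supd s r (s r - 1)).
Proof. by []. Qed.

Lemma runs_zero r s : s r = 0 -> runs (Basic (Zero r)) s s.
Proof. by move=> h t /=; split=> [[]|]. Qed.

(** The iteration may stop at any time, but the final zero test blocks unless [r] was counted down
    to exactly 0; from a negative value this never happens. *)
Definition loop r c := Seq (Star (Seq (Basic (Dec r)) c)) (Basic (Zero r)).

Section Loop.
Variables (r : nat) (c : cmd) (f : nat -> store).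
Hypothesis fr : forall i, f i r = f 0%N r - i%:Z.
Hypothesis fS : forall i, runs c (supd (f i) r (f i r - 1)) (f i.+1).

Lemma loop_body i : runs (Seq (Basic (Dec r)) c) (f i) (f i.+1).
Proof. exact: runs_seq (@runs_dec _ _) (fS i). Qed.

Lemma loop_sem_exists s' : sem (loop r c) (f 0%N) s' ->
  exists2 i, f 0%N r = i%:Z & s' = f i.
Proof.
move=> [t h [t0 ->]].
have [i tE] : exists i, t = f i.
  apply: (rtc_inv (I := fun t => exists i, t = f i) _ h); last by exists 0%N.
  by move=> u v [i ->] /(loop_body i) ->; exists i.+1.
by exists i => //; move: t0; rewrite tE fr; lia.
Qed.

Lemma runs_loop n : f 0%N r = n%:Z -> runs (loop r c) (f 0%N) (f n).
Proof.
move=> f0 t; split=> [/loop_sem_exists [i fi ->]|->].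
  by congr f; lia.
exists (f n) => /=; last by split=> //; rewrite fr; lia.
elim: n {f0} => [|n IH]; first exact: rtc_refl.
apply: rtc_trans IH _; apply: rtc_step (rtc_refl _ _).
exact: (runs_sem (loop_body n)).
Qed.

End Loop.

Lemma runs_move r t m s n : r != t -> s r = n%:Z ->
  runs (loop r (Basic (Inc t m))) s (supd (supd s r 0) t (s t + (m * n)%N%:Z)).
Proof.
move=> /eqP rt sr; pose f i := supd (supd s r (s r - i%:Z)) t (s t + (m * i)%N%:Z).
have f0 : f 0%N = s by rewrite /f; store_eq.
have -> : supd (supd s r 0) t (s t + (m * n)%N%:Z) = f n by rewrite /f; store_eq.
rewrite -[in X in runs _ X _]f0.
apply: runs_loop => [i|i|]; last by rewrite f0.
  by rewrite f0 /f /supd; case_regs; lia.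
have -> : f i.+1 = supd (supd (f i) r (f i r - 1)) t (supd (f i) r (f i r - 1) t + m%:Z).
  by rewrite /f; store_eq.
exact: runs_inc.
Qed.

Lemma sem_move_nonneg r t s s' : r != t ->
  sem (loop r (Basic (Inc t 1))) s s' ->
  exists2 n : nat, s r = n%:Z & s' = supd (supd s r 0) t (s t + n%:Z).
Proof.
move=> /eqP rt; pose f i := supd (supd s r (s r - i%:Z)) t (s t + i%:Z).
have f0 : f 0%N = s by rewrite /f; store_eq.
rewrite -[in X in sem _ X _]f0 => /loop_sem_exists[i|i|n].
- by rewrite f0 /f /supd; case_regs; lia.
- have -> : f i.+1 = supd (supd (f i) r (f i r - 1)) t (supd (f i) r (f i r - 1) t + 1%:Z).
    by rewrite /f; store_eq.
  exact: runs_inc.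
- by rewrite f0 => sn ->; exists n => //; rewrite /f; store_eq.
Qed.

(* Tests that register [r] is non-negative, given a scratch register [t]     *)
(* holding 0: a negative register can not be counted down to 0.               *)
Definition nonneg r t := Seq (loop r (Basic (Inc t 1))) (loop t (Basic (Inc r 1))).

Lemma sem_nonneg r t s s' : r != t -> s t = 0 ->
  sem (nonneg r t) s s' <-> 0 <= s r /\ s' = s.
Proof.
move=> rt st; have tr : t != r by rewrite eq_sym.
have rt' : r <> t by apply/eqP.
split=> [[u /(sem_move_nonneg rt) [n sn ->]]|[s0 ->]].
  move=> /(sem_move_nonneg tr) [m]; rewrite /supd eqxx => tm ->; split; first by lia.
  by store_eq.
have sn : s r = `|s r|%N%:Z by lia.
exists (supd (supd s r 0) t (s t + (1 * `|s r|)%N%:Z)); first exact/runs_sem/runs_move.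
have h : supd (supd s r 0) t (s t + (1 * `|s r|)%N%:Z) t = `|s r|%N%:Z.
  by rewrite /supd eqxx; lia.
by apply: runs_sem; apply: (eq_runs (runs_move 1 tr h)); store_eq.
Qed.

(** * Expressions and their evaluation by programs *)

Inductive expr :=
  | EReg of nat | ENum of nat | EPred of expr | EAdd of expr & expr
  | ECons of expr & expr.

(* Sealed, since the kernel would otherwise try to compute closed codes. *)
Fact code_cons_key : unit. Proof. by []. Qed.
Definition code_cons := locked_with code_cons_key (fun a b : nat => 2 ^ a * b.*2.+1)%N.

Lemma code_consE a b : code_cons a b = (2 ^ a * b.*2.+1)%N.
Proof. by rewrite [code_cons]unlock. Qed.

Fixpoint eval (E : expr) (s : store) : nat :=
  match E with
  | EReg r => `|s r|
  | ENum n => n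
  | EPred E => (eval E s).-1
  | EAdd E1 E2 => eval E1 s + eval E2 s
  | ECons E1 E2 => code_cons (eval E1 s) (eval E2 s)
  end.

(** [Dec] acts on integers whereas [.-1] truncates at 0; the two agree under this condition. *)
Fixpoint pred_safe (E : expr) (s : store) : Prop :=
  match E with
  | EReg _ | ENum _ => True
  | EPred E => (0 < eval E s)%N /\ pred_safe E s
  | EAdd E1 E2 | ECons E1 E2 => pred_safe E1 s /\ pred_safe E2 s
  end.

Fixpoint expr_regs (E : expr) : seq nat :=
  match E with
  | EReg r => [:: r]
  | ENum _ => [::]
  | EPred E => expr_regs E
  | EAdd E1 E2 | ECons E1 E2 => expr_regs E1 ++ expr_regs E2
  end.

Definition double r t := Seq (loop r (Basic (Inc t 2))) (loop t (Basic (Inc r 1))).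

(* Registers d, d+1, ... must hold 0. *)
Fixpoint compute (E : expr) (d : nat) : cmd :=
  match E with
  | EReg r => Seq (loop r (Seq (Basic (Inc d 1)) (Basic (Inc d.+1 1))))
                  (loop d.+1 (Basic (Inc r 1)))
  | ENum n => Basic (Inc d n)
  | EPred E => Seq (compute E d) (Basic (Dec d))
  | EAdd E1 E2 => Seq (compute E1 d) (Seq (compute E2 d.+1) (loop d.+1 (Basic (Inc d 1))))
  | ECons E1 E2 => Seq (compute E1 d) (Seq (compute E2 d.+1)
      (Seq (loop d.+1 (Basic (Inc d.+2 2))) (Seq (Basic (Inc d.+2 1))
      (Seq (loop d (double d.+2 d.+1)) (loop d.+2 (Basic (Inc d 1)))))))
  end.

Lemma runs_copy r d s n : (r < d)%N -> s d = 0 -> s d.+1 = 0 -> s r = n%:Z ->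
  runs (compute (EReg r) d) s (supd s d n%:Z).
Proof.
move=> rd sd sd1 sr.
(* Two copies are made at once; the one in [d.+1] then restores [r]. *)
pose f i := supd (supd (supd s r (s r - i%:Z)) d i%:Z) d.+1 i%:Z.
have f0 : f 0%N = s by rewrite /f; store_eq.
apply: (@runs_seq _ _ _ (f n)).
  rewrite -[in X in runs _ X _]f0; apply: runs_loop => [i|i|]; last by rewrite f0.
    by rewrite f0 /f /supd; case_regs; lia.
  apply: (@runs_seq _ _ _ (supd (supd (supd s r (s r - i.+1%:Z)) d i.+1%:Z) d.+1 i%:Z)).
    move=> t /=; split=> ->; rewrite /f; store_eq.
  by move=> t /=; split=> ->; rewrite /f; store_eq.
have h : f n d.+1 = n%:Z by rewrite /f /supd eqxx.
have dr : d.+1 != r by lia.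
by apply: (eq_runs (runs_move 1 dr h)); rewrite /f; store_eq.
Qed.

Lemma runs_double r t s n : r != t -> s t = 0 -> s r = n%:Z ->
  runs (double r t) s (supd s r (2 * n)%N%:Z).
Proof.
move=> rt st sr; have tr : t != r by rewrite eq_sym.
have rt' : r <> t by apply/eqP.
apply: runs_seq (runs_move 2 rt sr) _.
set u := supd _ _ _.
have h : u t = (2 * n)%N%:Z by rewrite /u /supd eqxx st; lia.
by apply: (eq_runs (runs_move 1 tr h)); rewrite /u; store_eq.
Qed.

Lemma eq_eval E s u d : all (fun r => (r < d)%N) (expr_regs E) ->
  (forall r, (r < d)%N -> u r = s r) -> eval E u = eval E s.
Proof.
move=> + us; elim: E => //= [r /andP[rd _]|E IH|E1 IH1 E2 IH2|E1 IH1 E2 IH2].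
- by rewrite us.
- by move=> /IH ->.
- by rewrite all_cat => /andP[/IH1 -> /IH2 ->].
- by rewrite all_cat => /andP[/IH1 -> /IH2 ->].
Qed.

Lemma eq_pred_safe E s u d : all (fun r => (r < d)%N) (expr_regs E) ->
  (forall r, (r < d)%N -> u r = s r) -> pred_safe E s -> pred_safe E u.
Proof.
move=> + us; elim: E => //= [E IH|E1 IH1 E2 IH2|E1 IH1 E2 IH2].
- by move=> Er [e0 /(IH Er) ?]; rewrite (eq_eval Er us).
- by rewrite all_cat => /andP[/IH1 + /IH2] => h1 h2 [/h1 ? /h2].
- by rewrite all_cat => /andP[/IH1 + /IH2] => h1 h2 [/h1 ? /h2].
Qed.

Lemma sub_regs d E : all (fun r => (r < d)%N) (expr_regs E) ->
  all (fun r => (r < d.+1)%N) (expr_regs E).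
Proof. by apply: sub_all => r; lia. Qed.

Lemma runs_compute E d s : all (fun r => (r < d)%N) (expr_regs E) ->
    (forall r, (r < d)%N -> 0 <= s r) -> (forall r, (d <= r)%N -> s r = 0) ->
    pred_safe E s ->
  runs (compute E d) s (supd s d (eval E s)%:Z).
Proof.
elim: E d s => [r|n|E IH|E1 IH1 E2 IH2|E1 IH1 E2 IH2] d s.
- move=> /= /andP[rd _] sp s0 _; apply: runs_copy => //; [exact: s0|exact: s0|].
  by have := sp r rd; lia.
- move=> _ sp s0 _ t /=; rewrite s0 // add0r; split=> ->//.
- move=> /= Er sp s0 [e0 ps]; apply: runs_seq (IH _ _ Er sp s0 ps) _.
  move=> t /=; split=> ->; store_eq.
- rewrite /= all_cat => /andP[r1 r2] sp s0 [ps1 ps2].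
  apply: runs_seq (IH1 _ _ r1 sp s0 ps1) _.
  set u := supd _ _ _.
  have us r : (r < d)%N -> u r = s r by rewrite /u /supd; case: eqP => //; lia.
  apply: runs_seq (IH2 d.+1 u (sub_regs r2) _ _ _) _.
  + move=> r rd; have [->|/eqP rd'] := eqVneq r d; first by rewrite /u /supd eqxx; lia.
    by rewrite us ?sp //; lia.
  + by move=> r rd; rewrite /u /supd; case: eqP => ?; [lia | apply: s0; lia].
  + exact: eq_pred_safe us ps2.
  rewrite (eq_eval r2 us).
  have h : supd u d.+1 (eval E2 s)%:Z d.+1 = (eval E2 s)%:Z by rewrite /supd eqxx.
  have dd : d.+1 != d by lia.
  have s0d := s0 d.+1 (leqnSn _).
  by apply: (eq_runs (runs_move 1 dd h)); rewrite /u; store_eq.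
- rewrite /= all_cat => /andP[r1 r2] sp s0 [ps1 ps2].
  apply: runs_seq (IH1 _ _ r1 sp s0 ps1) _.
  set u := supd _ _ _.
  have us r : (r < d)%N -> u r = s r by rewrite /u /supd; case: eqP => //; lia.
  apply: runs_seq (IH2 d.+1 u (sub_regs r2) _ _ _) _.
  + move=> r rd; have [->|/eqP rd'] := eqVneq r d; first by rewrite /u /supd eqxx; lia.
    by rewrite us ?sp //; lia.
  + by move=> r rd; rewrite /u /supd; case: eqP => ?; [lia | apply: s0; lia].
  + exact: eq_pred_safe us ps2.
  rewrite (eq_eval r2 us).
  have s0d1 := s0 d.+1 (leqnSn _); have s0d2 : s d.+2 = 0 by apply: s0; lia.
  move: (eval E1 s) (eval E2 s) @u us => a b u us.
  have h : supd u d.+1 b%:Z d.+1 = b%:Z by rewrite /supd eqxx.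
  have dd : d.+1 != d.+2 by lia.
  apply: runs_seq (runs_move 2 dd h) _.
  apply: runs_seq (@runs_inc _ _ _) _.
  set v := supd _ _ _.
  have vE : v = supd (supd s d a%:Z) d.+2 (b.*2.+1)%:Z by rewrite /v /u; store_eq.
  rewrite {}vE.
  (* Invariant of the doubling loop: [d] counts down from a while [d.+2] is doubled. *)
  pose f i := supd (supd s d (a%:Z - i%:Z)) d.+2 (2 ^ i * b.*2.+1)%N%:Z.
  have f0 : f 0%N = supd (supd s d a%:Z) d.+2 (b.*2.+1)%:Z by rewrite /f; store_eq.
  rewrite -f0; apply: (@runs_seq _ _ _ (f a)).
    apply: runs_loop => [i|i|].
    + by rewrite f0 /f /supd; case_regs; lia.
    + have h2 : supd (f i) d (f i d - 1) d.+2 = (2 ^ i * b.*2.+1)%N%:Z.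
        by rewrite /f /supd; case_regs; lia.
      have h1 : supd (f i) d (f i d - 1) d.+1 = 0.
        by rewrite /f /supd; case_regs; lia.
      have dd2 : d.+2 != d.+1 by lia.
      apply: (eq_runs (runs_double dd2 h1 h2)); rewrite /f ?expnS -?mulnA; store_eq.
    + by rewrite f0 /supd; case_regs; lia.
  have h3 : f a d.+2 = (2 ^ a * b.*2.+1)%N%:Z by rewrite /f /supd eqxx.
  have dd3 : d.+2 != d by lia.
  apply: (eq_runs (runs_move 1 dd3 h3)) => //.
  rewrite /f code_consE; move: (2 ^ a * _)%N => w; store_eq.
Qed.

(** * Simulating register machines *)

Lemma set_nth0E (l : seq nat) r v x :
  nth 0%N (set_nth 0%N l r v) x = if x == r then v else nth 0%N l x.
Proof. by rewrite nth_set_nth. Qed.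

(** A halted configuration is fixed by [rm_step], so the later of two halting times shows the same
    output as the earlier one. *)
Lemma rm_halts_with_inj p x y z :
  rm_halts_with p x y -> rm_halts_with p x z -> y = z.
Proof.
have stay c n : (size p <= c.1)%N -> iter n (rm_step p) c = c.
  move=> h; elim: n => //= n ->; case: c h => pc l /= h.
  by rewrite ltnNge h.
suff le i j y' z' : (i <= j)%N -> let c := iter i (rm_step p) (0%N, [:: x]) in
    let c' := iter j (rm_step p) (0%N, [:: x]) in
    (size p <= c.1)%N -> nth 0%N c.2 0 = y' -> nth 0%N c'.2 0 = z' -> y' = z'.
  move=> [i [hi <-]] [j [hj <-]]; have [ij|/ltnW ij] := leqP i j.
    exact: le ij hi erefl erefl.
  by apply/esym; exact: le ij hj erefl erefl.
move=> ij /= hi <- <-; congr (nth _ _.2 _).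
by rewrite -(subnK ij) iterD [RHS]stay.
Qed.

Lemma sem_alt c1 c2 s s' : sem (Alt c1 c2) s s' <-> sem c1 s s' \/ sem c2 s s'.
Proof. by []. Qed.

(** Registers 0 to 5 are reserved for the input and five guesses. Register 8 will receive the
    computed code, and is at the same time register 0 of the simulated machine. *)
Definition PC : nat := 6.
Definition scratch : nat := 7.
Definition reg (r : nat) : nat := (8 + r)%N.

Definition decs r n c := iter n (Seq (Basic (Dec r))) c.

Lemma sem_decs r n c s s' : sem (decs r n c) s s' <-> sem c (supd s r (s r - n%:Z)) s'.
Proof.
elim: n s => [|n IH] s /=.
  by rewrite (_ : supd _ _ _ = s) //; store_eq.
rewrite [in X in _ <-> X](_ : supd s r _ =
  supd (supd s r (s r - 1)) r (supd s r (s r - 1) r - n%:Z)); last first.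
  by store_eq.
by rewrite -IH -/(decs r n c); exact: (sem_seq _ _ (@runs_dec r s)).
Qed.

(** Subtracting [i] and testing for 0 blocks unless [PC] is [i]; as [PC] is then 0, an increment
    sets it. The two branches of [DEC] are guessed, and their tests exclude each other. *)
Definition sim_instr (i : nat) (a : instr) : cmd :=
  decs PC i (Seq (Basic (Zero PC))
    match a with
    | INC r => Seq (Basic (Inc (reg r) 1)) (Basic (Inc PC i.+1))
    | DEC r j => Alt (Seq (Basic (Zero (reg r))) (Basic (Inc PC j)))
        (Seq (Basic (Dec (reg r))) (Seq (nonneg (reg r) scratch) (Basic (Inc PC i.+1))))
    end).

Definition represents (c : rm_config) (s : store) : Prop :=
  [/\ s PC = c.1%:Z, s scratch = 0 & forall r, s (reg r) = (nth 0%N c.2 r)%:Z].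

Lemma reg_neq r : (reg r != PC) && (reg r != scratch).
Proof. by rewrite /reg /PC /scratch; lia. Qed.

Lemma reg_inj r r' : (reg r == reg r') = (r == r').
Proof. by rewrite /reg; lia. Qed.

Lemma sim_instr_sem c s i a s' : represents c s ->
  sem (sim_instr i a) s s' <->
    c.1 = i /\
    match a with
    | INC r => s' = supd (supd s PC i.+1%:Z) (reg r) (s (reg r) + 1)
    | DEC r j => (s (reg r) = 0 /\ s' = supd s PC j%:Z) \/
       (0 < s (reg r) /\ s' = supd (supd s PC i.+1%:Z) (reg r) (s (reg r) - 1))
    end.
Proof.
move=> [h1 h2 h3]; rewrite /sim_instr sem_decs.
set u := supd _ _ _; have uP : u PC = c.1%:Z - i%:Z by rewrite /u /supd eqxx h1.
have [ci|ci] := eqVneq c.1 i; last first.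
  split=> [[t [u0 _] _]|[ci' _]]; last by rewrite ci' eqxx in ci.
  by rewrite uP in u0; case/eqP: ci; lia.
have u0 : u PC = 0 by rewrite uP ci; lia.
rewrite (sem_seq _ _ (runs_zero u0)).
case: a => [r|r j].
  have /andP[/eqP nP /eqP nT] := reg_neq r.
  rewrite (sem_seq _ _ (@runs_inc _ _ _)) /=.
  have -> : supd (supd u (reg r) (u (reg r) + 1%:Z)) PC
      (supd u (reg r) (u (reg r) + 1%:Z) PC + i.+1%:Z) =
    supd (supd s PC i.+1%:Z) (reg r) (s (reg r) + 1) by rewrite /u; store_eq.
  by split=> [->|[_ ->]].
have /andP[/eqP nP /eqP nT] := reg_neq r.
have uT : u scratch = 0 by rewrite /u /supd -h2.
have ur : u (reg r) = s (reg r) by rewrite /u /supd; case: eqP.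
have zbr s'' : sem (Seq (Basic (Zero (reg r))) (Basic (Inc PC j))) u s'' <->
    s (reg r) = 0 /\ s'' = supd s PC j%:Z.
  have e : supd u PC (u PC + j%:Z) = supd s PC j%:Z by rewrite /u; store_eq.
  rewrite /= ur; split=> [[t [-> ->] ->]|[-> ->]]; first by split.
  by exists u.
have dbr s'' : sem (Seq (Basic (Dec (reg r))) (Seq (nonneg (reg r) scratch)
      (Basic (Inc PC i.+1)))) u s'' <->
    0 < s (reg r) /\ s'' = supd (supd s PC i.+1%:Z) (reg r) (s (reg r) - 1).
  rewrite (sem_seq _ _ (@runs_dec _ _)); set v := supd u _ _.
  have vT : v scratch = 0 by rewrite /v /supd; case: eqP => // e; case: nT.
  have nT' : reg r != scratch by apply/eqP.
  have vr : v (reg r) = s (reg r) - 1 by rewrite /v /supd eqxx ur.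
  have e : supd v PC (v PC + i.+1%:Z) = supd (supd s PC i.+1%:Z) (reg r) (s (reg r) - 1).
    by rewrite /v ur /u; store_eq.
  split=> [[t /(sem_nonneg _ nT' vT) [v0 ->] /= ->]|[s0 ->]].
    by split=> //; rewrite vr in v0; lia.
  by exists v => //; apply/sem_nonneg => //; split=> //; rewrite vr; lia.
rewrite sem_alt zbr dbr; tauto.
Qed.

Lemma sim_instr_step p c s s' : represents c s -> (c.1 < size p)%N ->
  sem (sim_instr c.1 (nth (INC 0) p c.1)) s s' -> represents (rm_step p c) s'.
Proof.
move=> rep lt /(sim_instr_sem _ _ _ rep) [_]; have [h1 h2 h3] := rep.
case: c rep lt h1 h2 h3 => pc l /= rep lt h1 h2 h3; rewrite lt.
case: (nth _ p pc) => [r ->|r j].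
  have /andP[/eqP nP /eqP nT] := reg_neq r.
  split=> [||r'] /=; rewrite /supd ?set_nth0E.
  - by case: eqP => // e; case: nP.
  - by case: eqP => // e; case: nT.
  - rewrite reg_inj; case: eqP => [_|_]; first by rewrite h3; lia.
    by have /andP[/negbTE -> _] := reg_neq r'.
have /andP[/eqP nP /eqP nT] := reg_neq r.
rewrite h3; case: (nth 0%N l r) (h3 r) => [|k] hr [[e ->]|[e ->]] //; try lia.
split=> [||r'] /=; rewrite /supd ?set_nth0E.
- by case: eqP => // e'; case: nP.
- by case: eqP => // e'; case: nT.
- rewrite reg_inj; case: eqP => [_|_]; first by lia.
  by have /andP[/negbTE -> _] := reg_neq r'.
Qed.

Lemma sim_instr_progress p c s : represents c s ->
  exists s', sem (sim_instr c.1 (nth (INC 0) p c.1)) s s'.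
Proof.
move=> rep; have [h1 h2 h3] := rep.
case: (nth _ p _) => [r|r j].
  by eexists; apply/(sim_instr_sem _ _ _ rep); split.
have [r0|r0] := eqVneq (s (reg r)) 0.
  by eexists; apply/(sim_instr_sem _ _ _ rep); split=> //; left.
eexists; apply/(sim_instr_sem _ _ _ rep); split=> //; right; split=> //.
by move: r0; rewrite h3; lia.
Qed.

(** Instructions are chosen freely, but only the one at [PC] does not block. The simulation may stop
    early; [halt_check] rejects it then. *)
Definition simulate (p : rm_prog) : cmd :=
  Star (foldr Alt (Basic Nop)
         [seq sim_instr i (nth (INC 0) p i) | i <- iota 0 (size p)]).

Lemma sem_alts (f : nat -> cmd) l s s' :
  sem (foldr Alt (Basic Nop) (map f l)) s s' <->
  s' = s \/ exists2 i, i \in l & sem (f i) s s'.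
Proof.
elim: l => [|i l IH] /=; first by split=> [->|[->|[]]]; [left|..].
rewrite IH; split=> [[h|[->|[j jl h]]]|[->|[j]]].
- by right; exists i; rewrite // inE eqxx.
- by left.
- by right; exists j; rewrite // inE jl orbT.
- by right; left.
- by rewrite inE => /orP[/eqP -> h|jl h]; [left | right; right; exists j].
Qed.

Lemma simulate_sound p c s s' : represents c s -> sem (simulate p) s s' ->
  exists k, represents (iter k (rm_step p) c) s'.
Proof.
move=> rep h.
apply: (rtc_inv (I := fun t => exists k, represents (iter k (rm_step p) c) t) _ h);
  last by exists 0%N.
move=> u v [k repk] /sem_alts [->|[i]]; first by exists k.
rewrite mem_iota add0n => /andP[_ il] hi.
exists k.+1; rewrite iterS; have [e _] := (sim_instr_sem _ _ _ repk).1 hi.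
by apply: sim_instr_step repk _ _; rewrite e.
Qed.

Lemma simulate_complete p c s k : represents c s ->
  exists2 s', sem (simulate p) s s' & represents (iter k (rm_step p) c) s'.
Proof.
elim: k c s => [|k IH] c s rep; first by exists s => //; exact: rtc_refl.
have [lt|ge] := ltnP c.1 (size p); last first.
  have [s' h1 h2] := IH c s rep; exists s' => //; rewrite iterSr.
  by case: c ge {rep} h2 => pc l /= ge h2; rewrite ltnNge ge.
have [t ht] := sim_instr_progress p rep.
have rept := sim_instr_step rep lt ht.
have [s' h1 h2] := IH _ _ rept; exists s'; last by rewrite iterSr.
apply: rtc_step h1; apply/sem_alts; right; exists c.1 => //.
by rewrite mem_iota.
Qed.

Definition halt_check (p : rm_prog) : cmd :=
  decs PC (size p) (Seq (nonneg PC scratch) (Basic (Zero (reg 0)))).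

Lemma halt_check_sem p c s s' : represents c s -> sem (halt_check p) s s' ->
  (size p <= c.1)%N /\ nth 0%N c.2 0 = 0%N.
Proof.
move=> [h1 h2 h3]; rewrite /halt_check sem_decs; set u := supd _ _ _.
have uT : u scratch = 0 by rewrite /u /supd -h2.
move=> [t /(sem_nonneg _ (isT : PC != scratch) uT) [u0 ->] /= [r0 _]].
have uP : u PC = c.1%:Z - (size p)%:Z by rewrite /u /supd eqxx h1.
have ur : u (reg 0) = (nth 0%N c.2 0)%:Z by rewrite -h3.
by rewrite uP in u0; rewrite ur in r0; split; lia.
Qed.

Lemma halt_check_complete p c s : represents c s ->
  (size p <= c.1)%N -> nth 0%N c.2 0 = 0%N -> exists s', sem (halt_check p) s s'.
Proof.
move=> [h1 h2 h3] hp c0; eexists; rewrite /halt_check sem_decs; set u := supd _ _ _.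
have uT : u scratch = 0 by rewrite /u /supd -h2.
exists u; first by apply/(sem_nonneg _ (isT : PC != scratch) uT); split=> //;
  rewrite /u /supd eqxx h1; lia.
by split=> //=; rewrite -[LHS]/(s (reg 0)) h3 c0.
Qed.

Lemma simulate_halts p x s : represents (0%N, [:: x]) s ->
  (exists s', sem (Seq (simulate p) (halt_check p)) s s') <-> rm_halts_with p x 0.
Proof.
move=> rep; split=> [[s' [t /(simulate_sound rep) [k repk]]]|[k /= [h1 h2]]].
  by move=> /(halt_check_sem repk) [h1 h2]; exists k.
have [t st rept] := simulate_complete p k rep.
by have [s' hs'] := halt_check_complete rept h1 h2; exists s', t.
Qed.

Definition guess r := Star (Basic (Inc r 1)).

Lemma sem_guess r s s' : sem (guess r) s s' <-> exists n : nat, s' = supd s r (s r + n%:Z).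
Proof.
split=> [h|[n ->]].
  apply: (rtc_inv (I := fun t => exists n : nat, t = supd s r (s r + n%:Z)) _ h).
    by move=> u v [n ->] /= ->; exists n.+1; store_eq.
  by exists 0%N; store_eq.
elim: n => [|n IH].
  by rewrite (_ : supd _ _ _ = s); [exact: rtc_refl | store_eq].
apply: (rtc_trans IH); apply: rtc_step (rtc_refl _ _) => /=; store_eq.
Qed.

Definition fill (vs : seq nat) : store := fun r => (nth 0%N vs r)%:Z.

Lemma sem_guess_fill vs c s' : 
  sem (Seq (guess (size vs)) c) (fill vs) s' <-> exists n, sem c (fill (rcons vs n)) s'.
Proof.
have e n : supd (fill vs) (size vs) (fill vs (size vs) + n%:Z) = fill (rcons vs n).
  apply/funext => x; rewrite /supd /fill nth_rcons nth_default //.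
  by case: ltngtP => // h; rewrite nth_default // ltnW.
split=> [[t /sem_guess [n ->] h]|[n h]]; first by exists n; rewrite -e.
by exists (fill (rcons vs n)) => //; apply/sem_guess; exists n; rewrite e.
Qed.

(* Guessing registers 1..5 and checking [E1] against register 0 saves having  *)
(* to decode register 0.                                                      *)
Definition self_check (E1 E2 : expr) (p : rm_prog) : cmd :=
  Seq (guess 1) (Seq (guess 2) (Seq (guess 3) (Seq (guess 4) (Seq (guess 5)
  (Seq (compute E1 8) (Seq (compute (EReg 0) 9)
  (Seq (loop 9 (Basic (Dec 8))) (Seq (Basic (Zero 8))
  (Seq (compute E2 8) (Seq (simulate p) (halt_check p))))))))))).

Lemma sem_self_check E1 E2 p k :
    all (fun r => (r < 8)%N) (expr_regs E1) -> all (fun r => (r < 8)%N) (expr_regs E2) ->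
    (forall s, pred_safe E1 s) -> (forall s, pred_safe E2 s) ->
  (exists s', sem (self_check E1 E2 p) (fill [:: k]) s') <->
  exists n1 n2 n3 n4 n5, let s := fill [:: k; n1; n2; n3; n4; n5] in
    eval E1 s = k /\ rm_halts_with p (eval E2 s) 0.
Proof.
move=> r1 r2 ps1 ps2.
(* Once the guesses are fixed, everything before the simulation is deterministic, apart from the
   comparison, which may block. *)
have main (s : store) (s_ge0 : forall r, 0 <= s r)
    (s_out : forall r, (6 <= r)%N -> s r = 0) (s_k : s 0%N = k%:Z) :
    (exists s', sem (Seq (compute E1 8) (Seq (compute (EReg 0) 9)
       (Seq (loop 9 (Basic (Dec 8))) (Seq (Basic (Zero 8))
       (Seq (compute E2 8) (Seq (simulate p) (halt_check p))))))) s s') <->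
    eval E1 s = k /\ rm_halts_with p (eval E2 s) 0.
  have s_out8 r : (8 <= r)%N -> s r = 0 by move=> h; apply: s_out; lia.
  have run1 := runs_compute r1 (fun r _ => s_ge0 r) s_out8 (ps1 s).
  set v := eval E1 s in run1 *; set u := supd s 8 _ in run1.
  have run2 : runs (compute (EReg 0) 9) u (supd u 9 k%:Z).
    by apply: runs_copy => //; rewrite /u /supd /= ?s_out.
  have run3 : runs (loop 9 (Basic (Dec 8))) (supd u 9 k%:Z) (supd s 8 (v%:Z - k%:Z)).
    pose f (i : nat) := supd (supd s 8 (v%:Z - i%:Z)) 9 (k%:Z - i%:Z).
    have s9 : s 9%N = 0 by rewrite s_out.
    have := @runs_loop 9 (Basic (Dec 8)) f _ _ k _.
    have f0 : f 0%N = supd u 9 k%:Z by rewrite /f /u; store_eq.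
    have fk : f k = supd s 8 (v%:Z - k%:Z) by rewrite /f; store_eq.
    rewrite f0 fk; apply => //.
    by move=> i t /=; split=> ->; rewrite /f; store_eq.
  set w := supd s 8 _ in run3.
  have w8 : w 8%N = v%:Z - k%:Z by rewrite /w /supd.
  have reduce s' : sem (Seq (compute E1 8) (Seq (compute (EReg 0) 9)
       (Seq (loop 9 (Basic (Dec 8))) (Seq (Basic (Zero 8))
       (Seq (compute E2 8) (Seq (simulate p) (halt_check p))))))) s s' <->
      sem (Seq (Basic (Zero 8)) (Seq (compute E2 8) (Seq (simulate p) (halt_check p)))) w s'.
    by rewrite (sem_seq _ _ run1) (sem_seq _ _ run2) (sem_seq _ _ run3).
  have [vk|vk] := eqVneq v k; last first.
    split=> [[s' /reduce [t [w0 _] _]]|[vk']]; last by rewrite vk' eqxx in vk.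
    by case/eqP: vk; rewrite w8 in w0; lia.
  have ws : w = s.
    by rewrite /w vk; have s8 : s 8%N = 0 by [rewrite s_out]; store_eq.
  have w0 : w 8%N = 0 by rewrite w8 vk; lia.
  have run4 := runs_compute r2 (fun r _ => s_ge0 r) s_out8 (ps2 s).
  (* Register 8 is [reg 0], so the computed code is already in place as the input of [p]. *)
  have rep : represents (0%N, [:: eval E2 s]) (supd s 8 (eval E2 s)%:Z).
    split=> [||[|r]] //; first by rewrite /supd /= s_out.
      by rewrite /supd /= s_out.
    rewrite /supd (_ : reg r.+1 == 8%N = false); last by rewrite /reg; lia.
    by rewrite /= nth_nil s_out // /reg; lia.
  rewrite -(simulate_halts p rep); split=> [[s' /reduce]|[_ [s' h]]].
    by rewrite (sem_seq _ _ (runs_zero w0)) ws (sem_seq _ _ run4) => h; split=> //; exists s'.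
  exists s'; apply/reduce.
  by rewrite (sem_seq _ _ (runs_zero w0)) ws (sem_seq _ _ run4).
have fill_ge0 vs r : 0 <= fill vs r by [].
have fill_out vs r : (size vs <= r)%N -> fill vs r = 0 by move=> h; rewrite /fill nth_default.
split.
- move=> [s' /(sem_guess_fill [:: k]) [n1 /(sem_guess_fill [:: k; n1]) [n2]]].
  move=> /(sem_guess_fill [:: k; n1; n2]) [n3 /(sem_guess_fill [:: k; n1; n2; n3]) [n4]].
  move=> /(sem_guess_fill [:: k; n1; n2; n3; n4]) [n5 h].
  by exists n1, n2, n3, n4, n5; apply/main => // [r r6|]; [exact: fill_out | exists s'].
- move=> [n1 [n2 [n3 [n4 [n5 /main [//|r h|//|s' h]]]]]]; first exact: fill_out.
  exists s'.
  apply/(sem_guess_fill [:: k]); exists n1.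
  apply/(sem_guess_fill [:: k; n1]); exists n2.
  apply/(sem_guess_fill [:: k; n1; n2]); exists n3.
  apply/(sem_guess_fill [:: k; n1; n2; n3]); exists n4.
  by apply/(sem_guess_fill [:: k; n1; n2; n3; n4]); exists n5.
Qed.

(** * The self-referential instance *)

(** Library codes of pairs, sequences and options are codes of lists, which [ECons] can build. *)
Lemma pickle_pairE (S T : countType) (x : S) (y : T) :
  pickle (x, y) = code_cons (pickle x) (code_cons (pickle y) 0).
Proof. by rewrite !code_consE. Qed.

Lemma pickle_seqE (T : countType) (x : T) (s : seq T) :
  pickle (x :: s) = code_cons (pickle x) (pickle s).
Proof. by rewrite !code_consE. Qed.

Lemma pickle_SomeE (T : countType) (x : T) : pickle (Some x) = code_cons (pickle x) 0.
Proof. by rewrite !code_consE. Qed.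

Lemma pickle_PoszE (n : nat) : pickle n%:Z = code_cons (code_cons n 0) 1.
Proof. by rewrite !code_consE. Qed.

(** A rational is coded by its reduced numerator and denominator, so the fraction must be in lowest
    terms. *)
Lemma pickle_fracE (a b : nat) : coprime a b -> (0 < b)%N ->
  pickle (a%:Q / b%:Q) = pickle (a%:Z, b%:Z).
Proof.
move=> ab b0; transitivity (pickle (valq (a%:Q / b%:Q))); first by [].
have cp : coprime `|a%:Z| `|b%:Z| by [].
congr pickle; rewrite [LHS]surjective_pairing; congr (_, _).
  by rewrite -/(numq _) coprimeq_num // gtr0_sg // mul1r.
by rewrite -/(denq _) coprimeq_den //; case: b b0 {ab cp}.
Qed.

Lemma code_cons_inj a b a' b' : code_cons a b = code_cons a' b' -> a = a' /\ b = b'.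
Proof.
rewrite !code_consE => h; have lE x y : logn 2 (2 ^ x * y.*2.+1) = x.
  by rewrite lognM ?expn_gt0 // pfactorK // lognE /= dvdn2 /= odd_double addn0.
have aa : a = a' by rewrite -(lE a b) h lE.
split=> //; move: h; rewrite aa => /eqP; rewrite eqn_pmul2l ?expn_gt0 // => /eqP.
by move=> [] /double_inj.
Qed.

Section Instance.
Variable B : cmd.

(** The input enters through the constant of one instruction, so the shape of the compiled machine
    is the same for all [k]. *)
Definition load (k : nat) := Seq (Basic (Inc 0 k)) B.
Definition reg_bound := (foldr maxn 0 (cmd_regs B)).+1.
(** This is [node_count (load k)] written without [k], so that the types of counters and states do
    not mention it. *)
Definition node_bound := (fresh_nodes B).+3.
Local Notation D := reg_bound.
Local Notation K := (reg_bound + node_bound)%N.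

Lemma load_regs k : all (fun r => (r < D)%N) (cmd_regs (load k)).
Proof.
rewrite /=; apply/allP => r rB; rewrite ltnS.
elim: (cmd_regs B) rB => //= x l IH; rewrite inE => /orP[/eqP ->|/IH h].
  exact: leq_maxl.
exact: leq_trans h (leq_maxr _ _).
Qed.

Definition act_count := size (compiled (load 0)).
Local Notation M := act_count.

Definition load_letters k : letters K := @compiled_letters D (load k).
Definition start_counters (x : 'I_K) : nat :=
  if (x < D)%N then 0 else (x - D != 0)%N.

Definition St : finType := state (load_letters 0).
Definition in_reg : 'I_K := Ordinal (ltn0Sn _ : (0 < K)%N).
Definition load_letter : 'I_M := @Ordinal M 2 isT.
Definition in_comp (b : bool) : gcomp K := Some (Some (in_reg, b)).

(* The first two states are the only ones whose transitions depend on k, and  *)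
(* the next three the only ones whose probabilities there depend on k.        *)
Definition head_states : seq St :=
  [:: @pend K (load_letters 0) load_letter (Some (in_comp false));
      @pend K (load_letters 0) load_letter (Some (in_comp true));
      @hub K (load_letters 0) (Some None);
      @hub K (load_letters 0) (Some (in_comp false));
      @hub K (load_letters 0) (Some (in_comp true));
      @start K (load_letters 0);
      @pend K (load_letters 0) (idle (load_letters 0)) None].

Definition tail_states : seq St := [seq y <- enum St | y \notin head_states].
Definition sts : seq St := head_states ++ tail_states.

Lemma mem_sts y : y \in sts.
Proof. by rewrite mem_cat mem_filter mem_enum andbT orbN. Qed.

Lemma uniq_sts : uniq sts.
Proof.
rewrite cat_uniq filter_uniq ?enum_uniq // andbT; apply/andP; split; first by [].
by apply/hasPn => y; rewrite mem_filter => /andP[].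
Qed.

Definition transitions k (x : St) (a : 'I_M) : option (St -> rat) :=
  @trans_mu K (load_letters k) start_counters x a.

Definition row k (x : St) : seq (option (seq rat)) :=
  [seq omap (fun nu => [seq nu y | y <- sts]) (transitions k x a) | a <- enum 'I_M].

Definition labels : seq nat := [seq state_lab (load_letters 0) y | y <- sts].

(** The states 5 and 6 are [start] and the pending idle letter with [None], by their positions in
    [head_states]. *)
Definition instance k : raw_inst :=
  (size sts, M, [seq row k x | x <- sts], labels, 5%N, 6%N, 2^-1).

Lemma transitions_distr k x a nu : transitions k x a = Some nu ->
  (forall y, 0 <= nu y) /\ \sum_y nu y = 1.
Proof. exact: (@trans_mu_distr K (load_letters k) start_counters x a nu). Qed.

Lemma sum_sts (nu : St -> rat) : \sum_(y <- sts) nu y = \sum_y nu y.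
Proof.
rewrite -[RHS]big_enum /=; apply: perm_big; apply: uniq_perm; rewrite ?uniq_sts ?enum_uniq //.
by move=> y; rewrite mem_sts mem_enum.
Qed.

Lemma instance_wf k : ri_wf (instance k).
Proof.
rewrite /ri_wf /ri_phi /ri_n /ri_m /ri_lab /ri_s1 /ri_s2 /instance; cbn [fst snd].
rewrite !size_map eqxx andTb; apply/and5P; split=> //.
- by rewrite all_map; apply/allP => x _; rewrite /preim /= size_map size_enum_ord.
- rewrite all_map; apply/allP => x _; rewrite -[preim _ _ _]/(all _ (row k x)) all_map.
  apply/allP => a _; rewrite -[preim _ _ _]/(if omap _ (transitions k x a) is Some l then
    [&& size l == size sts, all (fun q : rat => 0 <= q) l & \sum_(q <- l) q == 1] else true).
  case E: (transitions k x a) => [nu|//]; have [nu0 nu1] := transitions_distr E.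
  change (is_true [&& size [seq nu y | y <- sts] == size sts,
    all (fun q : rat => 0 <= q) [seq nu y | y <- sts]
    & \sum_(q <- [seq nu y | y <- sts]) q == 1]).
  rewrite size_map eqxx andTb; apply/andP; split.
    by rewrite all_map; apply/allP => y _; exact: nu0.
  by rewrite big_map sum_sts nu1.
Qed.

Definition view (i : 'I_(size sts)) : St := nth (@start K (load_letters 0)) sts i.
Definition unview (y : St) : 'I_(size sts) :=
  Ordinal (etrans (index_mem y sts) (mem_sts y)).

Lemma viewK : cancel view unview.
Proof. by move=> i; apply/val_inj; exact: (index_uniq _ (ltn_ord i) uniq_sts). Qed.

Lemma unviewK : cancel unview view.
Proof. by move=> y; rewrite /view nth_index ?mem_sts. Qed.

Lemma instance_answer (R : realType) k :
  ri_answer R (instance k) <-> exists s', sem B (fill [:: k]) s'.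
Proof.
have phiE (s : 'I_(size sts)) (a : 'I_M) :
    match mphi (ri_mdp (instance k)) s a, transitions k (view s) a with
    | Some mu, Some nu => forall t, mu t = nu (view t)
    | None, None => True
    | _, _ => False
    end.
  have -> : mphi (ri_mdp (instance k)) s a = omap (fun l (t : 'I_(size sts)) => nth 0 l t)
      (nth None (nth [::] [seq row k x | x <- sts] s) a) by [].
  rewrite (nth_map (@start K (load_letters 0))) // -/(view s).
  rewrite /row (nth_map a) ?size_enum_ord // nth_ord_enum.
  case: (transitions k (view s) a) => [nu|//] t.
  change (nth 0 [seq nu y | y <- sts] t = nu (view t)).
  by rewrite (nth_map (@start K (load_letters 0))).
have labE (s t : 'I_(size sts)) :
    (mlab (ri_mdp (instance k)) s == mlab (ri_mdp (instance k)) t) =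
    (state_lab (load_letters k) (view s) == state_lab (load_letters k) (view t)).
  have labE (i : 'I_(size sts)) : mlab (ri_mdp (instance k)) i =
      state_lab (load_letters k) (view i).
    by transitivity (nth 0%N labels i) => //; rewrite (nth_map (@start K (load_letters 0))).
  by rewrite !labE.
have h1 : (5 < size sts)%N by [].
have h2 : (6 < size sts)%N by [].
have main := @machine_gen_dist_min R K (load_letters k) start_counters 'I_(size sts) nat
  (mphi (ri_mdp (instance k))) (mlab (ri_mdp (instance k))) view unview viewK unviewK.
lapply main => {main} [main|s a]; last first.
  have := phiE s a; rewrite /transitions.
  case: (mphi (ri_mdp (instance k)) s a) => [mu|];
    by case: (trans_mu (load_letters k) start_counters (view s) a).
have {main} := main labE (Ordinal h1) (Ordinal h2) erefl erefl.
have -> : can_accept (load_letters k) (fun r => (start_counters r)%:Z) <->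
    exists s', sem B (fill [:: k]) s'.
  rewrite (@compiled_can_accept D (load k) (load_regs k) (fun=> 0)); last first.
    by move=> x; rewrite /start_counters /machine_config; case: ifP.
  have e : supd (fun=> 0) 0%N (0 + k%:Z) = fill [:: k].
    by apply/funext => -[|[|x]] //; rewrite /supd /fill /= add0r.
  split=> -[s' h]; exists s'; first by case: h => t ->; rewrite e.
  by exists (fill [:: k]) => //=; rewrite e.
move=> iff; rewrite -iff; split=> [[h1' [h2' h]]|h].
  by move: h; rewrite (eq_irrelevance h1' h1) (eq_irrelevance h2' h2).
by exists h1, h2.
Qed.

(** * How the instance depends on the input *)

Lemma load_ztest k (l : 'I_M) :
  @ztest K (load_letters k) l = @ztest K (load_letters 0) l.
Proof. by case: l => [[|[|[|i]]] h]. Qed.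

Lemma load_accepting k (l : 'I_M) :
  @accepting K (load_letters k) l = @accepting K (load_letters 0) l.
Proof. by case: l => [[|[|[|i]]] h]. Qed.

Lemma load_shift k (l : 'I_M) x : (l != load_letter) || (x != in_reg) ->
  @shift K (load_letters k) l x = @shift K (load_letters 0) l x.
Proof.
case: l => [[|[|[|i]]] h] //= hx; case: ifP => // _; case: eqP => // x0.
by case/negP: hx; apply/eqP/val_inj.
Qed.

Lemma load_shift_in k : @shift K (load_letters k) load_letter in_reg = k%:Z.
Proof. by []. Qed.

Lemma load_fault k l q :
  @fault K (load_letters k) rat l q = @fault K (load_letters 0) rat l q.
Proof. by case: q => [[[r b]|]|] //; rewrite /fault load_ztest ?load_accepting. Qed.

Lemma load_pend_mu k l q y : (forall b, l = load_letter -> q <> in_comp b) ->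
  @pend_mu K (load_letters k) rat l q y = @pend_mu K (load_letters 0) rat l q y.
Proof.
move=> ne; rewrite /pend_mu load_fault; congr (_ * _).
case: y => [//|[[q'|//]|//]]; case: q ne => [q|//] ne; rewrite /evolve.
suff -> : @decay K (load_letters k) rat l q = @decay K (load_letters 0) rat l q by [].
case: q ne => [[r b]|//] ne; rewrite /decay load_shift //.
rewrite -negb_and; apply/negP => /andP[/eqP le /eqP re].
by apply: (ne b le); rewrite /in_comp re.
Qed.

Lemma load_transitions k x a :
    (forall b, x <> @pend K (load_letters 0) load_letter (Some (in_comp b))) ->
  transitions k x a = transitions 0 x a.
Proof.
case: x => [b _|[q _|[l [q|] ne]]] //; rewrite /transitions /=; case: ifP => // _.
congr Some; apply/funext => y; apply: load_pend_mu => b le qe.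
by apply: (ne b); rewrite /pend le qe.
Qed.

Lemma load_row k x :
    (forall b, x <> @pend K (load_letters 0) load_letter (Some (in_comp b))) ->
  row k x = row 0 x.
Proof. by move=> ne; apply: eq_map => a; rewrite load_transitions. Qed.

(** The component survives the loading round with probability 1/2 (not tested) times 1/4 (unit)
    times 2^-k or 4^-k. *)
Definition slot_exponent k (b : bool) : nat := (if b then k + k + 3 else k + 3)%N.

Definition rest_value (y : St) : rat :=
  match y with
  | inl b => if b then 0 else 2^-1 * 2^-1
  | inr (inl None) => 2^-1 * (1 - 2^-1)
  | _ => 0
  end.

Lemma load_decay k b :
  @decay K (load_letters k) rat load_letter (Some (in_reg, b)) =
  2 / 2 ^+ slot_exponent k b.
Proof.
rewrite /decay load_shift_in /slot_exponent -exprnN.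
by case: b; rewrite ?expr1 ?expr2 !exprD; field; rewrite expf_neq0.
Qed.

Lemma load_letter_fault k b :
  @fault K (load_letters k) rat load_letter (in_comp b) = 2^-1.
Proof.
rewrite /fault /in_comp (_ : (in_reg \in _) = false) ?mulr0n ?addr0 //.
by rewrite inE orbF.
Qed.

Lemma slot_mu k b y :
  @pend_mu K (load_letters k) rat load_letter (in_comp b) y =
    if y == @hub K (load_letters 0) (Some None) then
      2^-1 - 1 / 2 ^+ slot_exponent k b
    else if y == @hub K (load_letters 0) (Some (in_comp b)) then
      1 / 2 ^+ slot_exponent k b
    else rest_value y.
Proof.
case: y => [[]|[[q|]|[l q]]]; rewrite /pend_mu ?load_letter_fault ?mulr0 //.
rewrite /evolve /in_comp load_decay.
case: q => [q|]; last by rewrite eqxx /=; field; rewrite expf_neq0.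
rewrite (_ : (inr _ == hub (Some None)) = false) // (_ : (None == Some q) = false) //.
have [<-|ne] := eqVneq (Some (in_reg, b)) q.
  by rewrite !eqxx /=; field; rewrite expf_neq0.
rewrite (_ : (Some (Some (in_reg, b)) == Some q) = false); last exact: negbTE ne.
rewrite (_ : (inr _ == hub (Some (Some (Some _)))) = false).
  by rewrite /= !mulr0n; ring.
by apply: negbTE; rewrite eq_sym.
Qed.

Definition idle_nones : seq (option (seq rat)) :=
  [seq None | _ <- behead (enum 'I_M)].

Lemma row_pend k l q :
  row k (@pend K (load_letters 0) l (Some q)) =
  Some [seq @pend_mu K (load_letters k) rat l q y | y <- sts] :: idle_nones.
Proof.
rewrite /row /idle_nones; have -> : enum 'I_M = idle (load_letters 0) :: behead (enum 'I_M).
  by rewrite /= enum_ordSl.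
rewrite map_cons /= /transitions /=; congr (_ :: _).
apply/eq_in_map => a.
by rewrite enum_ordSl /= => /mapP[i _ ->].
Qed.

Definition rest_row : seq rat := [seq rest_value y | y <- drop 5 sts].
Definition rest_phi : seq (seq (option (seq rat))) := [seq row 0 x | x <- drop 2 sts].

Definition slot_row k b : seq rat :=
  let g := 2^-1 - 1 / 2 ^+ slot_exponent k b in
  let x := 1 / 2 ^+ slot_exponent k b in
  [:: 0, 0, g, (if b then 0 else x), (if b then x else 0) & rest_row].

Lemma slot_rowE k b :
  [seq @pend_mu K (load_letters k) rat load_letter (in_comp b) y | y <- sts] = slot_row k b.
Proof.
rewrite (eq_map (@slot_mu k b)) /slot_row.
rewrite -[RHS](cat_take_drop 5) -[in LHS](cat_take_drop 5 sts) map_cat; congr (_ ++ _).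
  by case: b.
transitivity rest_row => //; apply/eq_in_map => y yd.
have ne x : x \in take 5 sts -> (y == x) = false.
  move=> xt; apply/eqP => yx; subst x.
  have := uniq_sts; rewrite -[sts](cat_take_drop 5) cat_uniq => /and3P[_ /hasPn h _].
  by have := h y yd; rewrite xt.
by rewrite !ne //; case: b.
Qed.

(** Only the load letter depends on [k], and only in its shift of register 0; hence just the two
    pending states of that letter and register have rows depending on [k]. *)
Lemma instance_phi k : [seq row k x | x <- sts] =
  [:: Some (slot_row k false) :: idle_nones, Some (slot_row k true) :: idle_nones & rest_phi].
Proof.
have tl : [seq row k x | x <- drop 2 sts] = rest_phi.
  apply/eq_in_map => x xd; apply: load_row => b xE; subst x.
  have := uniq_sts; rewrite -[sts](cat_take_drop 2) cat_uniq => /and3P[_ /hasPn h _].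
  by have := h _ xd; case: b {xd}.
rewrite -[in LHS](cat_take_drop 2 sts) map_cat tl -!slot_rowE -!row_pend.
reflexivity.
Qed.

End Instance.

(** * An expression for the code of the instance *)

Definition pair_expr E1 E2 := ECons E1 (ECons E2 (ENum 0)).
Definition int_expr E := ECons (ECons E (ENum 0)) (ENum 1).
Definition rat_expr E1 E2 := pair_expr (int_expr E1) (int_expr E2).
Definition pow2_expr E := ECons E (ENum 0).

Lemma eval_rat_expr (a b : nat) E1 E2 s : coprime a b -> (0 < b)%N ->
  eval E1 s = a -> eval E2 s = b -> eval (rat_expr E1 E2) s = pickle (a%:Q / b%:Q).
Proof.
move=> ab b0 e1 e2; rewrite pickle_fracE // pickle_pairE !pickle_PoszE.
by rewrite -e1 -e2.
Qed.

Definition slot_expr (E : expr) : expr := rat_expr (ENum 1) (pow2_expr (EAdd E (ENum 3))).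
(** 1/2 - 2^-(e+3) is (2^(e+2) - 1) / 2^(e+3), in lowest terms as the numerator is odd. *)
Definition rem_expr (E : expr) : expr :=
  rat_expr (EPred (pow2_expr (EAdd E (ENum 2)))) (pow2_expr (EAdd E (ENum 3))).
Definition zero_expr : expr := rat_expr (ENum 0) (ENum 1).

Lemma eval_zero_expr s : eval zero_expr s = pickle (0 : rat).
Proof. by rewrite (@eval_rat_expr 0 1) // mul0r. Qed.

Lemma eval_slot_expr E s : eval (slot_expr E) s = pickle (1 / 2 ^+ (eval E s + 3) : rat).
Proof.
rewrite (@eval_rat_expr 1 (2 ^ (eval E s + 3))) ?coprime1n ?expn_gt0 //.
  by rewrite -natrX.
by rewrite /= code_consE muln1.
Qed.

Lemma eval_rem_expr E s :
  eval (rem_expr E) s = pickle (2^-1 - 1 / 2 ^+ (eval E s + 3) : rat).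
Proof.
have p0 : (0 < 2 ^ (eval E s + 2))%N by rewrite expn_gt0.
rewrite (@eval_rat_expr (2 ^ (eval E s + 2)).-1 (2 ^ (eval E s + 3))) ?expn_gt0 //.
- congr pickle.
  have -> : (2 ^ (eval E s + 2)).-1%:Q = 2 ^+ (eval E s + 2) - 1 :> rat.
    by rewrite -pmulrn -subn1 natrB // natrX.
  rewrite -pmulrn natrX !exprD; field; rewrite expf_neq0 //.
- rewrite coprimeXr // coprime_sym prime_coprime // dvdn2 /= negbK.
  by rewrite -subn1 oddB // oddX addn2.
- by rewrite /= code_consE muln1.
- by rewrite /= code_consE muln1.
Qed.

Definition row_expr E b : expr :=
  ECons (ECons
    (ECons zero_expr (ECons zero_expr (ECons (rem_expr E)
      (if b then ECons zero_expr (ECons (slot_expr E) (EReg 4))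
       else ECons (slot_expr E) (ECons zero_expr (EReg 4))))))
   (ENum 0)) (EReg 3).

Definition encode_expr : expr :=
  pair_expr (pair_expr (pair_expr (pair_expr (pair_expr (EReg 1)
    (ECons (row_expr (EReg 0) false)
      (ECons (row_expr (EAdd (EReg 0) (EReg 0)) true) (EReg 2))))
    (EReg 5)) (ENum 5)) (ENum 6)) (rat_expr (ENum 1) (ENum 2)).

Definition check_expr : expr :=
  ECons (EReg 1) (ECons (EReg 2) (ECons (EReg 3) (ECons (EReg 4) (EReg 5)))).

Lemma eval_row_expr E b s (nones : seq (option (seq rat))) (rest : seq rat) :
    `|s 3%N|%N = pickle nones -> `|s 4%N|%N = pickle rest ->
  eval (row_expr E b) s =
  pickle (Some [:: 0, 0, 2^-1 - 1 / 2 ^+ (eval E s + 3),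
     (if b then 0 else 1 / 2 ^+ (eval E s + 3)),
     (if b then 1 / 2 ^+ (eval E s + 3) else 0) & rest] :: nones).
Proof.
move=> h3 h4; rewrite pickle_seqE pickle_SomeE 5!pickle_seqE.
case: b; cbn [row_expr eval]; rewrite (eval_zero_expr s) eval_rem_expr eval_slot_expr h3 h4.
  reflexivity.
reflexivity.
Qed.

Lemma eval_encode_expr B k n1 n2 n3 n4 n5 :
    n1 = pickle (size (sts B), act_count B) -> n2 = pickle (rest_phi B) ->
    n3 = pickle (idle_nones B) -> n4 = pickle (rest_row B) -> n5 = pickle (labels B) ->
  eval encode_expr (fill [:: k; n1; n2; n3; n4; n5]) = encode (instance B k).
Proof.
move=> e1 e2 e3 e4 e5; set s := fill _.
have h1 : `|s 1%N|%N = n1 := erefl _. have h2 : `|s 2%N|%N = n2 := erefl _.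
have h3 : `|s 3%N|%N = n3 := erefl _. have h4 : `|s 4%N|%N = n4 := erefl _.
have h5 : `|s 5%N|%N = n5 := erefl _. have h0 : `|s 0%N|%N = k := erefl _.
rewrite e1 in h1; rewrite e2 in h2; rewrite e3 in h3; rewrite e4 in h4; rewrite e5 in h5.
move: s h0 h1 h2 h3 h4 h5 {e1 e2 e3 e4 e5} => s h0 h1 h2 h3 h4 h5.
have ra : eval (row_expr (EReg 0) false) s =
    pickle (Some (slot_row B k false) :: idle_nones B).
  rewrite (eval_row_expr _ false h3 h4) /slot_row /slot_exponent; cbn [eval].
  by rewrite h0; reflexivity.
have rb : eval (row_expr (EAdd (EReg 0) (EReg 0)) true) s =
    pickle (Some (slot_row B k true) :: idle_nones B).
  rewrite (eval_row_expr _ true h3 h4) /slot_row /slot_exponent; cbn [eval].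
  by rewrite h0; reflexivity.
rewrite /encode /instance instance_phi 5!pickle_pairE.
rewrite (pickle_seqE (Some (slot_row B k false) :: idle_nones B)).
rewrite (pickle_seqE (Some (slot_row B k true) :: idle_nones B)) -ra -rb -h1 -h2 -h5.
have -> : pickle (2^-1 : rat) = eval (rat_expr (ENum 1) (ENum 2)) s.
  rewrite (@eval_rat_expr 1 2 (ENum 1) (ENum 2) s isT isT erefl erefl).
  by congr pickle; rewrite mul1r.
rewrite -[pickle 5%N]/5%N -[pickle 6%N]/6%N /encode_expr /pair_expr; cbn [eval].
reflexivity.
Qed.

Lemma encode_expr_safe s : pred_safe encode_expr s.
Proof. by do !split; rewrite /= code_consE muln_gt0 expn_gt0. Qed.

Theorem mainTheorem7 (R : realType) :
  ~ exists p : rm_prog, rm_decides_gdm R p.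
Proof.
move=> [p dec]; pose B := self_check check_expr encode_expr p.
pose n1 := pickle (size (sts B), act_count B); pose n2 := pickle (rest_phi B).
pose n3 := pickle (idle_nones B); pose n4 := pickle (rest_row B).
pose n5 := pickle (labels B).
(* The diagonal choice: [B] is already fixed, and the parts do not depend on the input, so their
   code may be taken as the input. By injectivity of [code_cons] only the right guesses pass the
   check. *)
pose k := code_cons n1 (code_cons n2 (code_cons n3 (code_cons n4 n5))).
have ansE : ri_answer R (instance B k) <-> rm_halts_with p (encode (instance B k)) 0.
  rewrite instance_answer sem_self_check //; last exact: encode_expr_safe.
  split.
    move=> [m1 [m2 [m3 [m4 [m5 [chk]]]]]].
    have [e1 /code_cons_inj [e2 /code_cons_inj [e3 /code_cons_inj [e4 e5]]]] := code_cons_inj chk.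
    by rewrite (eval_encode_expr k e1 e2 e3 e4 e5).
  move=> h; exists n1, n2, n3, n4, n5; split; first by [].
  by rewrite (eval_encode_expr k erefl erefl erefl erefl erefl).
have [yes no] := dec _ (instance_wf B k).
(* A positive answer would make [p] output both 1 and 0; a negative one makes it output 0, which
   makes the answer positive. *)
have nans : ~ ri_answer R (instance B k).
  by move=> a; have := rm_halts_with_inj (yes a) (ansE.1 a).
exact: nans (ansE.2 (no nans)).
Qed.
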